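(* Suppose that $F\in\operatorname{dom}(D)$ is such that $\mathbb{E}[F]=0$, and let $Z\sim N(0,1)$. Then $$d_{\mathcal W}(F,Z)\leq\sqrt{\frac{2}{\pi}}\;\mathbb{E}\Bigl|1-\sum_{k=1}^\infty\bigl(D_k\mathbb{E}[F\mid\mathcal{F}_k]\bigr)D_kF\Bigr|+\sum_{k=1}^\infty\mathbb{E}\Bigl[\bigl|D_k\mathbb{E}[F\mid\mathcal{F}_k]\bigr|\,(D_kF)^2\Bigr]$$ and $$d_{\mathcal K}(F,Z)\leq\mathbb{E}\Bigl|1-\sum_{k=1}^\infty\bigl(D_k\mathbb{E}[F\mid\mathcal{F}_k]\bigr)D_kF\Bigr|+2\sum_{k=1}^\infty\mathbb{E}\Bigl|\Bigl(D_k\bigl|D_k\mathbb{E}[F\mid\mathcal{F}_k]\bigr|\Bigr)D_kF\Bigr|+2\,\mathbb{E}\Bigl|\sum_{k=1}^\infty\mathbb{E}\bigl[\,|D_k\mathbb{E}[F\mid\mathcal{F}_k]|\,\big|\,\mathcal{G}_k\bigr]D_kF\Bigr|.$$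
   Context: Let $\mathbb{X}=(X_n)_{n\in\mathbb{N}}$ be a sequence of independent random variables on a probability space $(\Omega,\mathcal{A},\mathbb{P})$, $X_n$ taking values in an arbitrary measurable space. Let $\mathcal{F}=\sigma(\mathbb{X})$, $\mathcal{F}_n=\sigma(X_1,\dotsc,X_n)$, $\mathcal{G}_k=\sigma(X_j:j\neq k)$, $L^r_{\mathbb{X}}=L^r(\Omega,\mathcal{F},\mathbb{P})$; $\kappa$ is counting measure on $\mathbb{N}$, $\mathbb{P}_{\mathcal F}$ the restriction of $\mathbb{P}$ to $\mathcal{F}$. For $F\in L^1_{\mathbb{X}}$, $D_kF:=F-\mathbb{E}[F\mid\mathcal{G}_k]$. On the space of all $F\in L^2_{\mathbb{X}}$ that are $\mathcal{F}_n$-measurable for some $n$, put $DF:=(D_kF)_{k\in\mathbb{N}}\in L^2(\kappa\otimes\mathbb{P}_{\mathcal F})$; this is closable, its closure is denoted $D$ with domain $\operatorname{dom}(D)\subseteq L^2_{\mathbb{X}}$. Distances: $d_{\mathcal W}(Y,W)=\sup_h|\mathbb{E}[h(Y)]-\mathbb{E}[h(W)]|$ over all $1$-Lipschitz $h:\mathbb{R}\to\mathbb{R}$; $d_{\mathcal K}(Y,W)=\sup_{z\in\mathbb{R}}|\mathbb{P}(Y\le z)-\mathbb{P}(W\le z)|$. The right-hand sides of the bounds may be $+\infty$. *)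

(* Defs.v *)
From HB Require Import structures.
From mathcomp Require Import all_boot all_order all_algebra finmap.
From mathcomp Require Import all_classical all_reals all_analysis.

Set Implicit Arguments.
Unset Strict Implicit.
Unset Printing Implicit Defensive.

Import Order.TTheory GRing.Theory Num.Theory.
Import numFieldNormedType.Exports.

Local Open Scope classical_set_scope.
Local Open Scope ring_scope.

(* Indexing: the sequence is X 0, X 1, ..., where X k stands for the (k+1)-st
   variable of the one-based sequence (X_1, X_2, ...).  Every one-based index k
   in a sum thus becomes k.+1. *)

Section subsigma.
Context d (T : measurableType d) (R : realType) (P : probability T R).
Context (dE : nat -> measure_display) (E : forall n, measurableType (dE n)).

Definition mutually_independent (X : forall n, {RV P >-> E n}) : Prop :=
  forall (J : {fset nat}) (B : forall n, set (E n)),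
    (forall n, n \in J -> measurable (B n)) ->
    (P (\bigcap_(n in [set` J]) (X n @^-1` B n)) =
     \prod_(n <- J) P (X n @^-1` B n))%E.

(* A generating system of sigma(X_j : j \in J).  The measurable sets of
   [g_sigma_algebraType (gen X J)] are exactly that sigma-algebra, and its
   carrier is convertible to T. *)
Definition gen (X : forall n, {RV P >-> E n}) (J : set nat) : set (set T) :=
  \bigcup_(j in J) g_sigma_algebra_preimage (X j).

Definition gen_upto X n := gen X `I_n.
Definition gen_except X k := gen X (~` [set k]).

Notation OmegaX X := (g_sigma_algebraType (gen X [set: nat])).

Definition toOmegaX X : T -> OmegaX X := id.

Lemma measurable_toOmegaX X : measurable_fun [set: T] (toOmegaX X).
Proof.
move=> _ A mA; rewrite setTI; suff : <<s gen X [set: nat] >> `<=` measurable.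
  exact.
apply: smallest_sub; first exact: sigma_algebra_measurable.
by move=> B [j _ [C mC <-]]; exact: measurable_funP.
Qed.

HB.instance Definition _ X :=
  isMeasurableFun.Build _ _ T (OmegaX X) (toOmegaX X) (@measurable_toOmegaX X).

(* The restriction of P to sigma(X), as the image of P under the identity. *)
Definition PX X : probability (OmegaX X) R := distribution P (toOmegaX X).

(* Y is a version of the conditional expectation of F given <<s G>>. *)
Definition is_cexp (G : set (set T)) (F Y : T -> R) : Prop :=
  [/\ measurable_fun [set: g_sigma_algebraType G] Y,
      P.-integrable [set: T] (EFin \o Y)
    & forall A : set T, <<s G >> A ->
        (\int[P]_(w in A) (Y w)%:E = \int[P]_(w in A) (F w)%:E)%E].

(* A chosen version; the default value is only used when there is none, which
   does not happen for integrable F and <<s G>> `<=` measurable. *)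
Definition cexp (G : set (set T)) (F : T -> R) : T -> R :=
  xget (cst 0) [set Y | is_cexp G F Y].

Definition Dk X (k : nat) (F : T -> R) : T -> R :=
  F \- cexp (gen_except X k) F.

Definition L2X X (F : T -> R) : Prop := (F : OmegaX X -> R) \in Lfun (PX X) 2%:E.

Definition kappaPX X : {measure set (nat * OmegaX X) -> \bar R} :=
  (counting \x PX X)%E.

Definition L2kX X (H : nat * OmegaX X -> R) : Prop :=
  H \in Lfun (kappaPX X) 2%:E.

Definition D0_dom X (F : T -> R) : Prop :=
  L2X X F /\
  exists n, measurable_fun [set: g_sigma_algebraType (gen_upto X n)] F.

Definition D0 X (F : T -> R) : nat * OmegaX X -> R :=
  fun kw => Dk X kw.1 F kw.2.

(* The graph of the closure of D0. *)
Definition D_graph X (F : T -> R) (H : nat * OmegaX X -> R) : Prop :=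
  [/\ L2X X F, L2kX H &
    exists u : nat -> T -> R,
    [/\ forall m, D0_dom X (u m),
        'N[PX X]_2%:E[(fun w => (u m w - F w)%R%:E)]%E
          @[m --> \oo] --> 0%E
      & 'N[kappaPX X]_2%:E[(fun kw => (@D0 X (u m) kw - H kw)%R%:E)]%E
          @[m --> \oo] --> 0%E]].

Definition D_dom X (F : T -> R) : Prop := exists H, @D_graph X F H.

End subsigma.

Section distances.
Context (R : realType) d1 (T1 : measurableType d1) (P1 : probability T1 R).
Context d2 (T2 : measurableType d2) (P2 : probability T2 R).
Local Open Scope ereal_scope.

Definition dW (Y : {RV P1 >-> R}) (W : {RV P2 >-> R}) : \bar R :=
  ereal_sup [set `| 'E_P1[h \o Y] - 'E_P2[h \o W] |
            | h in [set h : R -> R | 1%R.-lipschitz h]].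

Definition dK (Y : {RV P1 >-> R}) (W : {RV P2 >-> R}) : \bar R :=
  ereal_sup [set `| cdf Y z - cdf W z | | z in [set: R]].

End distances.

(* The law is compared on Borel sets only: [distribution] and [normal_prob]
   are set functions defined on all subsets of R. *)
Definition standard_normal (R : realType) d (T : measurableType d)
    (P : probability T R) (Z : {RV P >-> R}) : Prop :=
  forall A : set R, measurable A -> distribution P Z A = normal_prob 0 1 A.

(* Main.v *)
(* Write [a_k = D_k E[F | F_k]] and [b_k = D_k F].  The [a_k] are the martingale
   increments of [F], so [F = \sum_k a_k] in L2, and [a_k] is orthogonal to all
   G_k-measurable functions.  Let [f] solve a Stein equation
   [f' x - x f x = h x - E[h Z]].  Since [F - b_k = E[F | G_k]],
     [E[F f(F)] = \sum_k E[a_k (f(F) - f(F - b_k))]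
                = \sum_k (E[a_k b_k f'(F)] + E[a_k rem_k])],
   where [rem_k] is the remainder of a first order Taylor expansion of [f].
   Hence [E[h(F)] - E[h(Z)]] is at most
   [sup |f'| * E|1 - \sum_k a_k b_k| + |\sum_k E[a_k rem_k]|].
   For 1-Lipschitz [h], [|f'| <= sqrt (2 / pi)] and [f'] is 2-Lipschitz, so that
   [|rem_k| <= b_k ^+ 2].  For [h] the indicator of a half-line, [|f'| <= 1] and
   [|rem_k| <= b_k (g(F) - g(F - b_k))] with [g x = x f x + 1_{x > z} - Phi z]
   nondecreasing and [|g| <= 1]; split [|a_k| = D_k |a_k| + E[|a_k| | G_k]]. *)

From HB Require Import structures.
Require Import Defs.
From mathcomp Require Import all_boot all_order all_algebra finmap.
From mathcomp Require Import all_classical all_reals all_analysis.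
From mathcomp Require Import measurable_realfun ring lra.

Set Implicit Arguments.
Unset Strict Implicit.
Unset Printing Implicit Defensive.

Import Order.TTheory GRing.Theory Num.Theory.
Import numFieldNormedType.Exports.
Import HBNNSimple.

Local Open Scope classical_set_scope.
Local Open Scope ring_scope.

(** * Gaussian integrals and Mills inequalities *)

(** The series [\sum_k a_k] converges only in L2, so [E[F f(F)]] is never expanded directly. The
    expansion is made exactly for [E[E[F | F_n] f(F)]], which is a finite sum, and [n] goes to
    infinity only in the resulting inequality. Membership of [F] in the domain enters twice: [F] is
    an L2-limit of functionals of finitely many coordinates, hence [E[F | F_n]] tends to [F]; and
    [\sum_k E[b_k ^+ 2]] is finite. With the Bessel inequality [\sum_k E[a_k ^+ 2] <= E[F ^+ 2]],
    the second fact makes [\sum_k a_k b_k] converge absolutely almost surely and in L1, so that the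
    [limn] of the statement is a true limit almost surely. Conditional expectations are chosen
    versions, and identities between different ones hold only almost surely. The equality [F - b_k =
    E[F | G_k]] is pointwise by definition, so the Taylor expansion can be made pointwise. As [h] is
    only Lipschitz or an indicator, [f] has no second derivative to work with: remainders are
    controlled through the monotonicity of [x f x] and its variants, which reduces to Mills
    inequalities. *)

Section real_derivatives.
Context {R : realType}.
Implicit Types (f g : R -> R) (x y a b : R).

Lemma is_derive_add f g x a b : is_derive x 1 f a -> is_derive x 1 g b ->
  is_derive x 1 (fun y => f y + g y) (a + b).
Proof. exact: is_deriveD. Qed.

Lemma is_derive_opp f x a : is_derive x 1 f a ->
  is_derive x 1 (fun y => - f y) (- a).
Proof. exact: is_deriveN. Qed.

Lemma is_derive_mul f g x a b : is_derive x 1 f a -> is_derive x 1 g b ->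
  is_derive x 1 (fun y => f y * g y) (a * g x + f x * b).
Proof.
by move=> fa gb; apply: (is_derive_eq (is_deriveM fa gb)); rewrite addrC mulrC.
Qed.

Lemma is_derive_inv f x a : f x != 0 -> is_derive x 1 f a ->
  is_derive x 1 (fun y => (f y)^-1) (- a / f x ^+ 2).
Proof.
move=> fx fa; apply: (is_derive_eq (is_deriveV fx fa)).
by rewrite /GRing.scale/= mulNr mulrC mulNr.
Qed.

Lemma is_derive_const x a : is_derive x 1 (fun=> a) 0.
Proof. exact: is_derive_cst. Qed.

Lemma is_derive_var x : is_derive x 1 (fun y : R => y) 1.
Proof. exact: is_derive_id. Qed.

Lemma is_derive_continuous f x a : is_derive x 1 f a -> {for x, continuous f}.
Proof.
by move=> [df _]; exact/differentiable_continuous/derivable1_diffP.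
Qed.

Lemma is_derive_mean_value f (df : R -> R) a b : a <= b ->
  (forall x, a <= x <= b -> is_derive x 1 f (df x)) ->
  exists2 c, a <= c <= b & f b - f a = df c * (b - a).
Proof.
move=> ab dfx; case: (@MVT_segment _ f df a b ab).
- by move=> x; rewrite in_itv/= => /andP[ax xb]; apply: dfx; rewrite !ltW.
- apply: derivable_within_continuous => x; rewrite in_itv/= => xab.
  by have [] := dfx _ xab.
- by move=> c; rewrite in_itv/= => cab fba; exists c.
Qed.

Lemma is_derive_ndecr f (df : R -> R) a b : a <= b ->
  (forall x, a <= x <= b -> is_derive x 1 f (df x)) ->
  (forall x, a <= x <= b -> 0 <= df x) -> f a <= f b.
Proof.
move=> ab dfx df0; have [c cab fba] := is_derive_mean_value ab dfx.
by rewrite -subr_ge0 fba mulr_ge0 ?df0// subr_ge0.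
Qed.

Lemma is_derive_nincr f (df : R -> R) a b : a <= b ->
  (forall x, a <= x <= b -> is_derive x 1 f (df x)) ->
  (forall x, a <= x <= b -> df x <= 0) -> f b <= f a.
Proof.
move=> ab dfx df0; rewrite -lerN2.
apply: (@is_derive_ndecr (fun x => - f x) (fun x => - df x)) => // x xab.
  by apply: is_derive_opp; exact: dfx.
by rewrite oppr_ge0 df0.
Qed.

(** Stands in for a limit at infinity: a monotone function with a tail bounded below by [- (C / y)]
    is nonnegative. *)
Lemma ge0_of_le_invr x (C : R) :
  (forall y, 0 < y -> - (C / y) <= x) -> 0 <= x.
Proof.
move=> H; rewrite leNgt; apply/negP => x0.
have C0 : 0 < C.
  by have := H 1 ltr01; rewrite divr1 lerNl => /(lt_le_trans _); apply; lra.
(* For [y = 2 C / (- x)] the assumption reads [x / 2 <= x], impossible for [x < 0]. *)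
have /H : 0 < 2 * C / (- x) by rewrite divr_gt0 ?mulr_gt0//; lra.
have -> : C / (2 * C / - x) = - x / 2 by field; rewrite lt_eqF// gt_eqF.
lra.
Qed.

End real_derivatives.

Section standard_gaussian.
Context {R : realType}.
Notation mu := (@lebesgue_measure R).
Implicit Types x y z : R.

Definition phi : R -> R := normal_pdf 0 1.

Lemma phiE x : phi x = phi 0 * expR (- (x ^+ 2 / 2)).
Proof.
rewrite /phi normal_pdfE ?oner_eq0//= /normal_fun !subr0 expr1n.
by rewrite expr0n/= oppr0 mul0r expR0 mulr1 mulNr.
Qed.

Lemma phi_gt0 x : 0 < phi x.
Proof.
rewrite phiE mulr_gt0 ?expR_gt0// /phi normal_pdfE ?oner_eq0//=.
by rewrite mulr_gt0 ?expR_gt0 ?normal_peak_gt0 ?oner_eq0.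
Qed.

Lemma phi_ge0 x : 0 <= phi x. Proof. exact/ltW/phi_gt0. Qed.

Lemma phi_neq0 x : phi x != 0. Proof. by rewrite gt_eqF// phi_gt0. Qed.

Lemma phi_le x : phi x <= phi 0.
Proof.
rewrite phiE ger_pMr ?phi_gt0// -expR0 ler_expR oppr_le0.
by rewrite divr_ge0// sqr_ge0.
Qed.

Lemma phiN x : phi (- x) = phi x.
Proof. by rewrite phiE sqrrN -phiE. Qed.

(** The Wasserstein constant arises in this form: the derivative of the Stein solution is a sum of
    two terms, each at most [phi 0]. *)
Lemma sqrt_2_pi : Num.sqrt (2 / pi) = 2 * phi 0 :> R.
Proof.
rewrite /phi normal_pdfE ?oner_eq0//= /normal_fun subr0 expr0n/= oppr0 mul0r.
rewrite expR0 mulr1 /normal_peak expr1n mul1r.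
apply/eqP; rewrite -(eqrXn2 (n := 2))// ?mulr_ge0 ?invr_ge0 ?sqrtr_ge0//.
move: (@pi R) (pi_gt0 R) => p p0.
rewrite sqr_sqrtr ?divr_ge0 ?ltW// exprMn exprVn sqr_sqrtr; last lra.
by rewrite -[p *+ 2]mulr_natr; apply/eqP; field; rewrite gt_eqF.
Qed.

Lemma is_derive_phi x : is_derive x 1 phi (- (x * phi x)).
Proof.
have -> : phi = (fun y => phi 0 * expR (- (y * y / 2))).
  by apply/funext => y; rewrite phiE expr2.
have dsq : is_derive x 1 (fun y => - (y * y / 2)) (- x).
  apply: (is_derive_eq (is_derive_opp (is_derive_mul
    (is_derive_mul (is_derive_var x) (is_derive_var x))
    (is_derive_const x 2^-1)))).
  by lra.
have dexp : is_derive x 1 (expR \o (fun y => - (y * y / 2))) (expR (- (x * x / 2)) * - x).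
  exact: is_derive1_comp.
apply: (is_derive_eq (is_derive_mul (is_derive_const x (phi 0)) dexp)) => /=.
ring.
Qed.

Lemma continuous_phi : continuous phi.
Proof. by move=> x; exact: is_derive_continuous (is_derive_phi x). Qed.

Lemma measurable_phi : measurable_fun setT phi.
Proof. exact: continuous_measurable_fun continuous_phi. Qed.

(** From [expR (y ^+ 2 / 2) >= 1 + y ^+ 2 / 2]. It supplies both [phi_cvg0] and the tail estimate in
    [lower_mills]. *)
Lemma phi_mul_le y : 0 < y -> y * phi y <= 2 * phi 0 / y.
Proof.
move=> y0; rewrite phiE expRN ler_pdivlMr//.
have e0 : 0 < expR (y ^+ 2 / 2) by exact: expR_gt0.
have -> : y * (phi 0 * (expR (y ^+ 2 / 2))^-1) * y =
  y * y * phi 0 / expR (y ^+ 2 / 2) by ring.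
rewrite ler_pdivrMr//.
have := expR_ge1Dx (y ^+ 2 / 2); have := phi_gt0 0; rewrite expr2; nra.
Qed.

Lemma integral_phi : (\int[mu]_x (phi x)%:E = 1)%E.
Proof. exact: integral_normal_pdf. Qed.

Lemma integrable_phi : mu.-integrable setT (EFin \o phi).
Proof. exact: integrable_normal_pdf. Qed.

Lemma phi_cvg0 : phi x @[x --> +oo] --> (0 : R).
Proof.
have small (e x : R) : 0 < e -> 1 < x -> 2 * phi 0 / e < x -> phi x <= e.
  move=> e0 x1; rewrite ltr_pdivrMr// => xe.
  have x0 : 0 < x by rewrite (lt_trans _ x1).
  have := phi_mul_le x0; rewrite ler_pdivlMr// => xphi.
  have : x * phi x < e by rewrite -(ltr_pM2l x0); nra.
  have := phi_ge0 x; nra.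
apply/cvgrPdist_le => e e0; near=> x.
rewrite sub0r normrN ger0_norm ?phi_ge0//; apply: small => //; near: x;
  by apply: nbhs_pinfty_gt; rewrite num_real.
Unshelve. all: by end_near. Qed.

Lemma integral_id_phi_cy :
  (\int[mu]_(x in `[0%R, +oo[) (x * phi x)%:E = (phi 0)%:E)%E.
Proof.
rewrite (@ge0_continuous_FTC2y _ _ (fun x => - phi x) _ 0).
- by rewrite EFinN sub0e oppeK.
- by move=> x x0; rewrite mulr_ge0// phi_ge0.
- apply: continuous_subspaceT => x.
  by apply: continuousM; [exact: cvg_id|exact: continuous_phi].
- by rewrite -[X in _ --> X]oppr0; apply: cvgN; exact: phi_cvg0.
- by move=> x _; have [] := is_derive_opp (is_derive_phi x).
- apply: cvg_at_right_filter.
  by apply: continuousN; exact: continuous_phi.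
- move=> x _; rewrite derive1E.
  by have [_ ->] := is_derive_opp (is_derive_phi x); rewrite opprK.
Qed.

Lemma integrable_id_phi : mu.-integrable setT (EFin \o (fun x => x * phi x)).
Proof.
have mf : measurable_fun setT (fun x => x * phi x).
  by apply: measurable_funM => //; exact: measurable_phi.
apply/integrableP; split; first exact/measurable_EFinP.
under eq_integral do rewrite /= normrM (ger0_norm (phi_ge0 _)).
(* The function [|x| phi x] is even, so its integral is twice the one over the half-line. *)
rewrite ge0_symfun_integralT.
- rewrite -set_itvcy (_ : integral _ _ _ = (phi 0)%:E) -?EFinM ?ltry//.
  apply: etrans integral_id_phi_cy; apply: eq_integral => x.
  by rewrite inE/= in_itv/= andbT => x0; rewrite ger0_norm.
- by move=> x; rewrite mulr_ge0 ?phi_ge0.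
- move=> x; apply: continuousM; last exact: continuous_phi.
  exact: norm_continuous.
- by move=> x /=; rewrite normrN phiN.
Qed.

(** Linear growth is what constants, the identity and Lipschitz functions share; their integrability
    against [phi] all comes from here. *)
Lemma integrable_lin_phi (k : R -> R) (A B : R) : measurable_fun setT k ->
  (forall x, `|k x| <= A + B * `|x|) ->
  mu.-integrable setT (EFin \o (fun x => k x * phi x)).
Proof.
move=> mk kAB.
apply: (@le_integrable _ _ _ mu setT measurableT _
  (EFin \o (fun x => A * phi x + B * `|x * phi x|))).
- by apply/measurable_EFinP; apply: measurable_funM => //; exact: measurable_phi.
- move=> x _; rewrite /= lee_fin normrM (ger0_norm (phi_ge0 _)).
  rewrite normrM (ger0_norm (phi_ge0 _)) mulrA -mulrDl normrM (ger0_norm (phi_ge0 _)).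
  by rewrite ler_wpM2r ?phi_ge0// (le_trans (kAB x))// ler_norm.
- apply: eq_integrable (measurableT) _ _ _ (integrableD measurableT
    (integrableZl measurableT A integrable_phi)
    (integrableZl measurableT B (integrable_norm integrable_id_phi))) => //.
Qed.

End standard_gaussian.

Section gaussian_integrals.
Context {R : realType}.
Notation mu := (@lebesgue_measure R).
Implicit Types (x y z c : R) (k : R -> R).

Definition phi_integrable k :=
  mu.-integrable setT (EFin \o (fun t => k t * phi t)).

(** Variation of constants: for continuous [k], the quotient [lower_int k x / phi x] solves
    [f' x - x f x = k x]. If [gauss_int k = 0] it also equals [- upper_int k x / phi x], which gives
    control at both ends of the line. *)
Definition lower_int k x : R := \int[mu]_(t in `]-oo, x]) (k t * phi t).
Definition upper_int k x : R := \int[mu]_(t in `]x, +oo[) (k t * phi t).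
Definition gauss_int k : R := \int[mu]_t (k t * phi t).

Lemma phi_integrableD k1 k2 : phi_integrable k1 -> phi_integrable k2 ->
  phi_integrable (fun t => k1 t + k2 t).
Proof.
move=> i1 i2; apply: eq_integrable (integrableD _ i1 i2) => // t _ /=.
by rewrite mulrDl EFinD.
Qed.

Lemma phi_integrableZ k c : phi_integrable k -> phi_integrable (fun t => c * k t).
Proof.
move=> ik; apply: eq_integrable (integrableZl _ c ik) => // t _ /=.
by rewrite -mulrA EFinM.
Qed.

Lemma phi_integrable_cst c : phi_integrable (fun=> c).
Proof.
apply: (@integrable_lin_phi _ _ `|c| 0); first exact: measurable_cst.
by move=> x; rewrite mul0r addr0.
Qed.

Lemma phi_integrable_id : phi_integrable id.
Proof.
apply: (@integrable_lin_phi _ _ 0 1); first exact: measurable_id.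
by move=> x; rewrite mul1r add0r.
Qed.

Lemma phi_integrableS k (A : set R) : measurable A -> phi_integrable k ->
  mu.-integrable A (EFin \o (fun t => k t * phi t)).
Proof. by move=> mA; apply: integrableS. Qed.

Lemma lower_upper_int k x : phi_integrable k ->
  lower_int k x + upper_int k x = gauss_int k.
Proof.
move=> ik; rewrite /upper_int -(@Rintegral_itvB _ _ -oo%O) //.
  by rewrite set_itvNyy addrC subrK.
by rewrite set_itvNyy.
Qed.

Lemma lower_intD k1 k2 x : phi_integrable k1 -> phi_integrable k2 ->
  lower_int (fun t => k1 t + k2 t) x = lower_int k1 x + lower_int k2 x.
Proof.
move=> i1 i2; rewrite /lower_int -RintegralD//; try exact: phi_integrableS.
by apply: eq_Rintegral => t _; rewrite mulrDl.
Qed.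

Lemma upper_intD k1 k2 x : phi_integrable k1 -> phi_integrable k2 ->
  upper_int (fun t => k1 t + k2 t) x = upper_int k1 x + upper_int k2 x.
Proof.
move=> i1 i2; rewrite /upper_int -RintegralD//; try exact: phi_integrableS.
by apply: eq_Rintegral => t _; rewrite mulrDl.
Qed.

Lemma lower_intZ k c x : phi_integrable k ->
  lower_int (fun t => c * k t) x = c * lower_int k x.
Proof.
move=> ik; rewrite /lower_int -RintegralZl//; try exact: phi_integrableS.
by apply: eq_Rintegral => t _; rewrite mulrA.
Qed.

Lemma upper_intZ k c x : phi_integrable k ->
  upper_int (fun t => c * k t) x = c * upper_int k x.
Proof.
move=> ik; rewrite /upper_int -RintegralZl//; try exact: phi_integrableS.
by apply: eq_Rintegral => t _; rewrite mulrA.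
Qed.

Lemma lower_int_le k1 k2 x : phi_integrable k1 -> phi_integrable k2 ->
  (forall t, t <= x -> k1 t <= k2 t) -> lower_int k1 x <= lower_int k2 x.
Proof.
move=> i1 i2 k12; apply: le_Rintegral; try exact: phi_integrableS => //.
- by [].
- by move=> t /=; rewrite in_itv/= => tx; rewrite ler_wpM2r ?phi_ge0 ?k12.
Qed.

Lemma upper_int_le k1 k2 x : phi_integrable k1 -> phi_integrable k2 ->
  (forall t, x <= t -> k1 t <= k2 t) -> upper_int k1 x <= upper_int k2 x.
Proof.
move=> i1 i2 k12; apply: le_Rintegral; try exact: phi_integrableS => //.
- by [].
- move=> t /=; rewrite in_itv/= andbT => tx.
  by rewrite ler_wpM2r ?phi_ge0 ?k12 ?ltW.
Qed.

Lemma is_derive_lower_int k x : continuous k -> phi_integrable k ->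
  is_derive x 1 (lower_int k) (k x * phi x).
Proof.
move=> ck ik; have x1 : x < x + 1 by rewrite ltrDl.
have ckphi : {for x, continuous (fun t => k t * phi t)}.
  by apply: continuousM; [exact: ck|exact: continuous_phi].
have FTC := @continuous_FTC1 _ (fun t => k t * phi t) -oo%O x (x + 1) x1
  (phi_integrableS (measurable_itv _) ik).
have [dk dkE] := FTC (ltNyr _) ckphi.
by apply: DeriveDef; [exact: dk|rewrite -derive1E dkE].
Qed.

Definition Phi x : R := lower_int (fun=> 1) x.

Lemma lower_int_cst c x : lower_int (fun=> c) x = c * Phi x.
Proof.
rewrite /Phi -lower_intZ; last exact: phi_integrable_cst.
by rewrite mulr1.
Qed.

Lemma gauss_int1 : gauss_int (fun=> 1) = 1.
Proof.
rewrite /gauss_int /Rintegral; under eq_integral do rewrite mul1r.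
by rewrite integral_phi.
Qed.

Lemma upper_int_cst c x : upper_int (fun=> c) x = c * (1 - Phi x).
Proof.
rewrite -gauss_int1 -(lower_upper_int x (phi_integrable_cst 1)) addrAC subrr add0r.
rewrite -upper_intZ; last exact: phi_integrable_cst.
by rewrite mulr1.
Qed.

Lemma Phi_ge0 x : 0 <= Phi x.
Proof.
have := @lower_int_le (fun=> 0) (fun=> 1) x (phi_integrable_cst _) (phi_integrable_cst _).
by rewrite lower_int_cst mul0r; apply => *.
Qed.

Lemma Phi_le1 x : Phi x <= 1.
Proof.
have := @upper_int_le (fun=> 0) (fun=> 1) x (phi_integrable_cst _) (phi_integrable_cst _).
by rewrite !upper_int_cst mul0r mul1r subr_ge0; apply => *.
Qed.

Lemma is_derive_Phi x : is_derive x 1 Phi (phi x).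
Proof.
apply: (is_derive_eq (@is_derive_lower_int (fun=> 1) x _ (phi_integrable_cst 1))).
  exact: cst_continuous.
by rewrite mul1r.
Qed.

Lemma Phi0 : Phi 0 = 2^-1.
Proof.
suff : Phi 0 = upper_int (fun=> 1) 0.
  by rewrite upper_int_cst mul1r; lra.
rewrite /upper_int Rintegral_itv_obnd_cbnd; last first.
  exact: (phi_integrableS _ (phi_integrable_cst 1)).
rewrite /Phi /lower_int /Rintegral; congr fine.
have := @ge0_integration_by_substitutionNy R phi 0; rewrite oppr0.
under [in X in _ -> X = _]eq_integral do rewrite mul1r.
under [in X in _ -> _ = X]eq_integral do rewrite mul1r.
move=> ->.
- by apply: eq_integral => t _; rewrite /= phiN.
- exact/continuous_subspaceT/continuous_phi.
- by move=> t _; exact: phi_ge0.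
Qed.

Lemma PhiN x : Phi (- x) = 1 - Phi x.
Proof.
have : Phi x + Phi (- x) = Phi 0 + Phi (- 0).
  apply: (@is_derive_0_is_cst _ (fun t => Phi t + Phi (- t))) => t.
  have dN : is_derive t 1 (fun y : R => - y) (- 1).
    exact: is_derive_opp (is_derive_var t).
  have d2 : is_derive t 1 (Phi \o (fun y : R => - y)) (phi (- t) * - 1).
    by apply: is_derive1_comp; exact: is_derive_Phi.
  apply: (is_derive_eq (is_derive_add (is_derive_Phi t) d2)).
  by rewrite phiN; ring.
by rewrite oppr0 Phi0; lra.
Qed.

Lemma lower_int_id x : lower_int id x = - phi x.
Proof.
have : lower_int id x + phi x = lower_int id 0 + phi 0.
  apply: (@is_derive_0_is_cst _ (fun t => lower_int id t + phi t)) => t.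
  apply: (is_derive_eq (is_derive_add (is_derive_lower_int t _ phi_integrable_id)
    (is_derive_phi t))); first by move=> y; exact: cvg_id.
  by rewrite subrr.
suff -> : lower_int id 0 = - phi 0 by lra.
rewrite /lower_int -[phi 0]/(fine (phi 0)%:E) -integral_id_phi_cy -fineN.
rewrite /Rintegral; congr fine.
have := @ge0_integration_by_substitutionNy R (fun t => - (t * phi t)) 0.
rewrite oppr0 => H.
(* The integrand is nonpositive on the left half-line, while the substitution of [- t] for [t] asks
   for a nonnegative one; it is applied to the opposite. *)
transitivity (- (\int[mu]_(t in `]-oo, 0%R]) (- (t * phi t))%:E))%E.
  rewrite -integral_ge0N; last first.
    move=> t /=; rewrite in_itv/= => t0.
    by rewrite lee_fin -mulNr mulr_ge0 ?phi_ge0 ?oppr_ge0.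
  by apply: eq_integral => t _; rewrite EFinN oppeK.
rewrite H.
- congr (- _)%E; apply: eq_integral => t _ /=.
  by rewrite phiN mulNr opprK.
- apply: continuous_subspaceT => t; apply: is_derive_continuous.
  exact: is_derive_opp (is_derive_mul (is_derive_var t) (is_derive_phi t)).
- move=> t; rewrite in_itv/= => t0.
  by rewrite -mulNr mulr_ge0 ?phi_ge0 ?oppr_ge0 ?ltW.
Qed.

Lemma gauss_int_id : gauss_int id = 0.
Proof.
rewrite -(lower_upper_int 0 phi_integrable_id) lower_int_id.
rewrite /upper_int Rintegral_itv_obnd_cbnd; last first.
  exact: (phi_integrableS _ phi_integrable_id).
by rewrite /Rintegral integral_id_phi_cy addNr.
Qed.

Lemma upper_int_id x : upper_int id x = phi x.
Proof.
have := lower_upper_int x phi_integrable_id.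
by rewrite gauss_int_id lower_int_id; lra.
Qed.

(** For a standard normal [N], [lower_mean x] is [E[(x - N)^+]] and [upper_mean x] is
    [E[(N - x)^+]], in closed form. *)
Definition lower_mean x : R := phi x + x * Phi x.
Definition upper_mean x : R := phi x - x * (1 - Phi x).

Lemma lower_meanE x : lower_int (fun t => x + -1 * t) x = lower_mean x.
Proof.
rewrite lower_intD ?lower_intZ ?lower_int_cst ?lower_int_id /lower_mean; first ring.
- exact: phi_integrable_id.
- exact: phi_integrable_cst.
- exact: (phi_integrableZ _ phi_integrable_id).
Qed.

Lemma upper_meanE x : upper_int (fun t => t + - x) x = upper_mean x.
Proof.
rewrite upper_intD ?upper_int_cst ?upper_int_id /upper_mean; first ring.
- exact: phi_integrable_id.
- exact: phi_integrable_cst.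
Qed.

Lemma lower_mean_ge0 x : 0 <= lower_mean x.
Proof.
rewrite -lower_meanE -(mul0r (Phi x)) -lower_int_cst; apply: lower_int_le.
- exact: phi_integrable_cst.
- exact: phi_integrableD (phi_integrable_cst _) (phi_integrableZ _ phi_integrable_id).
- by move=> t tx; lra.
Qed.

Lemma upper_mean_ge0 x : 0 <= upper_mean x.
Proof.
rewrite -upper_meanE -(mul0r (1 - Phi x)) -upper_int_cst; apply: upper_int_le.
- exact: phi_integrable_cst.
- exact: phi_integrableD phi_integrable_id (phi_integrable_cst _).
- by move=> t tx; lra.
Qed.

Lemma lower_meanN x : lower_mean (- x) = upper_mean x.
Proof. by rewrite /lower_mean /upper_mean phiN PhiN; ring. Qed.

End gaussian_integrals.

(** * Mills inequalities and the product bound on the one-sided means *)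

Section gaussian_inequalities.
Context {R : realType}.
Implicit Types x y z c : R.

Lemma is_derive_sqr x : is_derive x 1 (fun y : R => y ^+ 2) (2 * x).
Proof.
have := is_derive_mul (is_derive_var x) (is_derive_var x).
by move=> /is_derive_eq; apply; rewrite mul1r mulr1 mulr_natl mulr2n.
Qed.

(** At [x = - t] this is the classical tail bound [1 - Phi t >= t phi t / (1 + t ^+ 2)]. The
    expression has derivative [2 lower_mean], hence is nondecreasing, and [phi_mul_le] bounds it
    below near minus infinity. *)
Lemma lower_mills x : 0 <= (1 + x ^+ 2) * Phi x + x * phi x.
Proof.
pose W y : R := (1 + y ^+ 2) * Phi y + y * phi y.
have dW y : is_derive y 1 W (2 * lower_mean y).
  apply: (is_derive_eq (is_derive_add
    (is_derive_mul (is_derive_add (is_derive_const y 1) (is_derive_sqr y)) (is_derive_Phi y))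
    (is_derive_mul (is_derive_var y) (is_derive_phi y)))).
  by rewrite /lower_mean; ring.
have W_ndecr y : y <= x -> W y <= W x.
  move=> yx; apply: (is_derive_ndecr yx (fun t _ => dW t)) => t _.
  by rewrite mulr_ge0 ?lower_mean_ge0.
have W_tail y : 0 < y -> - (2 * phi 0 / y) <= W (- y).
  move=> y0; rewrite /W phiN mulNr.
  have : 0 <= (1 + (- y) ^+ 2) * Phi (- y).
    by rewrite mulr_ge0 ?Phi_ge0// addr_ge0 ?sqr_ge0.
  have := phi_mul_le y0; lra.
have [x0|x0] := leP 0 x.
  by rewrite addr_ge0// mulr_ge0 ?phi_ge0 ?Phi_ge0// addr_ge0 ?sqr_ge0.
apply: (@ge0_of_le_invr _ _ (2 * phi 0)) => y y0.
(* The maximum guarantees [- y' <= x], so that monotonicity applies, while [y <= y'] keeps the tail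
   estimate at [y]. *)
pose y' := Num.max y (- x).
have y'0 : 0 < y' by rewrite lt_max y0.
apply: (@le_trans _ _ (- (2 * phi 0 / y'))).
  rewrite lerN2 ler_wpM2l ?mulr_ge0 ?phi_ge0//.
  by rewrite lef_pV2 ?posrE// le_max lexx.
apply: le_trans (W_tail _ y'0) (W_ndecr _ _).
by rewrite lerNl le_max lexx orbT.
Qed.

Lemma upper_mills x : 0 <= (1 + x ^+ 2) * (1 - Phi x) - x * phi x.
Proof.
by have := lower_mills (- x); rewrite PhiN phiN sqrrN mulNr.
Qed.

Lemma centered_Phi_le x : 0 <= x -> 2 * Phi x - 1 <= 2 * phi 0 * x.
Proof.
move=> x0; pose d y : R := 2 * phi 0 * y - (2 * Phi y - 1).
suff : d 0 <= d x by rewrite /d Phi0; lra.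
apply: (@is_derive_ndecr _ d (fun y => 2 * phi 0 - 2 * phi y) _ _ x0) => y _.
  apply: (is_derive_eq (is_derive_add
    (is_derive_mul (is_derive_const y (2 * phi 0)) (is_derive_var y))
    (is_derive_opp (is_derive_add (is_derive_mul (is_derive_const y 2) (is_derive_Phi y))
    (is_derive_const y (- 1)))))).
  ring.
by have := phi_le y; lra.
Qed.

(** This expression carries the sign of the derivative [dN] in [upper_lower_mean_le]. It vanishes at
    0, and its own derivative is the defect in [centered_Phi_le]. *)
Lemma phi_defect_ge0 x : 0 <= x ->
  0 <= phi 0 * x ^+ 2 - (2 * Phi x - 1) * x + 2 * (phi 0 - phi x).
Proof.
move=> x0.
pose J y : R := phi 0 * y ^+ 2 - (2 * Phi y - 1) * y + 2 * (phi 0 - phi y).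
suff : J 0 <= J x by rewrite {1}/J subrr expr0n !mulr0 subrr addr0.
apply: (@is_derive_ndecr _ J (fun y => 2 * phi 0 * y - (2 * Phi y - 1)) _ _ x0) => y.
  move=> _; apply: (is_derive_eq (is_derive_add (is_derive_add
    (is_derive_mul (is_derive_const y (phi 0)) (is_derive_sqr y))
    (is_derive_opp (is_derive_mul (is_derive_add (is_derive_mul (is_derive_const y 2)
      (is_derive_Phi y)) (is_derive_const y (- 1))) (is_derive_var y))))
    (is_derive_mul (is_derive_const y 2) (is_derive_add (is_derive_const y (phi 0))
      (is_derive_opp (is_derive_phi y)))))).
  ring.
by move=> /andP[y0 _]; have := centered_Phi_le y0; lra.
Qed.

(* For [x > 0] the claim is [N x >= 0], where [N] is nonincreasing and
   [- phi 0 / y <= N y] at infinity. *)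
Lemma upper_lower_mean_le x : upper_mean x * lower_mean x <= phi 0 * phi x.
Proof.
(* Reflection exchanges the two means and preserves [phi]. *)
wlog x0 : x / 0 <= x => [wh|].
  have [x0|/ltW x0] := leP 0 x; first exact: wh.
  have := wh (- x); rewrite oppr_ge0 => /(_ x0).
  by rewrite lower_meanN phiN -lower_meanN opprK mulrC.
move: x0; rewrite le_eqVlt => /orP[/eqP <-|x0].
  by rewrite /upper_mean /lower_mean !mul0r subr0 addr0.
pose N y : R :=
  Phi y * (1 - Phi y) - phi y * (phi y + y * (2 * Phi y - 1) - phi 0) * (y ^+ 2)^-1.
suff N0 : 0 <= N x.
  have : 0 <= x ^+ 2 * N x by rewrite mulr_ge0 ?sqr_ge0.
  have -> : x ^+ 2 * N x = x ^+ 2 * (Phi x * (1 - Phi x))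
      - phi x * (phi x + x * (2 * Phi x - 1) - phi 0).
    by rewrite /N; field; rewrite gt_eqF.
  by rewrite /upper_mean /lower_mean; lra.
pose dN y : R := - (phi y *
  (phi 0 * y ^+ 2 - (2 * Phi y - 1) * y + 2 * (phi 0 - phi y)) / y ^+ 3).
have isN y : 0 < y -> is_derive y 1 N (dN y).
  move=> y0; apply: (is_derive_eq (is_derive_add
    (is_derive_mul (is_derive_Phi y) (is_derive_add (is_derive_const y 1)
      (is_derive_opp (is_derive_Phi y))))
    (is_derive_opp (is_derive_mul (is_derive_mul (is_derive_phi y)
      (is_derive_add (is_derive_add (is_derive_phi y) (is_derive_mul (is_derive_var y)
        (is_derive_add (is_derive_mul (is_derive_const y 2) (is_derive_Phi y))
          (is_derive_const y (- 1))))) (is_derive_const y (- phi 0))))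
     (is_derive_inv _ (is_derive_sqr y)))))).
    by rewrite sqrf_eq0 gt_eqF.
  by rewrite /dN; field; rewrite gt_eqF.
apply: (@ge0_of_le_invr _ _ (phi 0)) => y y0.
pose y' := Num.max y x.
have y'0 : 0 < y' by rewrite lt_max y0.
have xy' : x <= y' by rewrite le_max lexx orbT.
apply: (@le_trans _ _ (- (phi 0 / y'))).
  rewrite lerN2 ler_wpM2l ?phi_ge0//.
  by rewrite lef_pV2 ?posrE// le_max lexx.
apply: (@le_trans _ _ (N y')).
  have P1 := Phi_le1 y'; have P0 := Phi_ge0 y'; have p0 := phi_le y'.
  have pp := phi_gt0 y'.
  have : phi y' * (phi y' + y' * (2 * Phi y' - 1) - phi 0) * (y' ^+ 2)^-1 <=
      phi 0 / y'.
    rewrite ler_pdivrMr ?exprn_gt0//.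
    have -> : phi 0 / y' * y' ^+ 2 = phi 0 * y' by field; rewrite gt_eqF.
    have : y' * (2 * Phi y' - 1) <= y' * 1 by rewrite ler_pM2l//; lra.
    nra.
  have : 0 <= Phi y' * (1 - Phi y') by rewrite mulr_ge0 ?subr_ge0.
  by rewrite /N; lra.
apply: (@is_derive_nincr _ N dN _ _ xy') => t /andP[xt _].
  by apply: isN; rewrite (lt_le_trans x0).
have t0 : 0 < t by rewrite (lt_le_trans x0).
rewrite oppr_le0 divr_ge0 ?exprn_ge0 ?(ltW t0)// mulr_ge0 ?phi_ge0//.
exact: phi_defect_ge0 (ltW t0).
Qed.

End gaussian_inequalities.

(** * Solutions of the Stein equation *)

Section stein_kolmogorov.
Context {R : realType}.
Implicit Types x y z c : R.

(** The two Mills ratios. They solve [f' = x f + 1] and [f' = x f - 1], which up to a factor is the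
    Stein equation of a half-line on either side of the threshold. *)
Definition lower_ratio x : R := Phi x / phi x.
Definition upper_ratio x : R := (1 - Phi x) / phi x.

Lemma is_derive_lower_ratio x :
  is_derive x 1 lower_ratio (x * lower_ratio x + 1).
Proof.
apply: (is_derive_eq (is_derive_mul (is_derive_Phi x)
  (is_derive_inv (phi_neq0 x) (is_derive_phi x)))).
by rewrite /lower_ratio; field; exact: phi_neq0.
Qed.

Lemma is_derive_upper_ratio x :
  is_derive x 1 upper_ratio (x * upper_ratio x - 1).
Proof.
apply: (is_derive_eq (is_derive_mul
  (is_derive_add (is_derive_const x 1) (is_derive_opp (is_derive_Phi x)))
  (is_derive_inv (phi_neq0 x) (is_derive_phi x)))).
by rewrite /upper_ratio; field; exact: phi_neq0.
Qed.

(** The derivative of [t * lower_ratio t] is the expression of [lower_mills] divided by [phi t]. *)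
Lemma mul_lower_ratio_ndecr x y : x <= y ->
  x * lower_ratio x <= y * lower_ratio y.
Proof.
move=> xy; apply: (@is_derive_ndecr _ (fun t => t * lower_ratio t)
  (fun t => ((1 + t ^+ 2) * Phi t + t * phi t) / phi t) _ _ xy) => t _.
  apply: (is_derive_eq (is_derive_mul (is_derive_var t) (is_derive_lower_ratio t))).
  by rewrite /lower_ratio; field; exact: phi_neq0.
by rewrite divr_ge0 ?phi_ge0 ?lower_mills.
Qed.

Lemma mul_upper_ratio_ndecr x y : x <= y ->
  x * upper_ratio x <= y * upper_ratio y.
Proof.
move=> xy; apply: (@is_derive_ndecr _ (fun t => t * upper_ratio t)
  (fun t => ((1 + t ^+ 2) * (1 - Phi t) - t * phi t) / phi t) _ _ xy) => t _.
  apply: (is_derive_eq (is_derive_mul (is_derive_var t) (is_derive_upper_ratio t))).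
  by rewrite /upper_ratio; field; exact: phi_neq0.
by rewrite divr_ge0 ?phi_ge0 ?upper_mills.
Qed.

Lemma mul_lower_ratio_geN1 x : - 1 <= x * lower_ratio x.
Proof.
rewrite /lower_ratio mulrA ler_pdivlMr ?phi_gt0// mulN1r.
by have := lower_mean_ge0 x; rewrite /lower_mean; lra.
Qed.

Lemma mul_upper_ratio_le1 x : x * upper_ratio x <= 1.
Proof.
rewrite /upper_ratio mulrA ler_pdivrMr ?phi_gt0// mul1r.
by have := upper_mean_ge0 x; rewrite /upper_mean; lra.
Qed.

(** The bounded solution of [f' x - x f x = 1_{x <= z} - Phi z]: each branch uses the Mills ratio
    that stays bounded on its side. *)
Definition stein_ind z x : R :=
  if x <= z then (1 - Phi z) * lower_ratio x else Phi z * upper_ratio x.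

Section fixed_threshold.
Variable z : R.
Let f := stein_ind z.

(** The branches agree at the threshold, so the formula of the right one holds there too. This lets
    increments be split at [z]. *)
Lemma stein_ind_upper x : z <= x -> f x = Phi z * upper_ratio x.
Proof.
rewrite le_eqVlt => /orP[/eqP <-|zx]; last by rewrite /f /stein_ind leNgt zx.
by rewrite /f /stein_ind lexx /lower_ratio /upper_ratio; ring.
Qed.

Lemma stein_ind_lower x : x <= z -> f x = (1 - Phi z) * lower_ratio x.
Proof. by rewrite /f /stein_ind => ->. Qed.

Lemma mul_stein_ind_ndecr x y : x <= y -> x * f x <= y * f y.
Proof.
have lo a b : a <= b -> b <= z -> a * f a <= b * f b.
  move=> ab bz; rewrite !stein_ind_lower// ?(le_trans ab)// !(mulrCA _ (1 - _)).
  by rewrite ler_wpM2l ?mul_lower_ratio_ndecr// subr_ge0 Phi_le1.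
have up a b : a <= b -> z <= a -> a * f a <= b * f b.
  move=> ab za; rewrite !stein_ind_upper// ?(le_trans za)// !(mulrCA _ (Phi z)).
  by rewrite ler_wpM2l ?mul_upper_ratio_ndecr// Phi_ge0.
move=> xy; have [yz|/ltW zy] := leP y z; first exact: lo.
have [zx|/ltW xz] := leP z x; first exact: up.
exact: le_trans (lo _ _ xz (lexx z)) (up _ _ zy (lexx z)).
Qed.

(** Monotonicity allows [x] to be replaced by [Num.max x z], where the upper branch and
    [mul_upper_ratio_le1] apply. *)
Lemma mul_stein_ind_le x : x * f x <= Phi z.
Proof.
apply: (@le_trans _ _ (Num.max x z * f (Num.max x z))).
  by apply: mul_stein_ind_ndecr; rewrite le_max lexx.
rewrite stein_ind_upper ?le_max ?lexx ?orbT// mulrCA.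
by rewrite ler_piMr ?Phi_ge0 ?mul_upper_ratio_le1.
Qed.

Lemma mul_stein_ind_ge x : Phi z - 1 <= x * f x.
Proof.
apply: (@le_trans _ _ (Num.min x z * f (Num.min x z))); last first.
  by apply: mul_stein_ind_ndecr; rewrite ge_min lexx.
rewrite stein_ind_lower ?ge_min ?lexx ?orbT// mulrCA.
have := mul_lower_ratio_geN1 (Num.min x z); have := Phi_le1 z; nra.
Qed.

(** On one side of the threshold the derivative is [x f x] plus a constant, hence nondecreasing, and
    the mean slope lies between its values at the endpoints. *)
Lemma stein_ind_lower_incr a b : a <= b -> b <= z ->
  (a * f a + 1 - Phi z) * (b - a) <= f b - f a <= (b * f b + 1 - Phi z) * (b - a).
Proof.
move=> ab bz; have az := le_trans ab bz.
have [c /andP[ac cb] cE] := @is_derive_mean_value _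
  (fun x => (1 - Phi z) * lower_ratio x)
  (fun x => (1 - Phi z) * (x * lower_ratio x + 1)) a b ab
  (fun x _ => is_derive_eq (is_derive_mul (is_derive_const x (1 - Phi z))
    (is_derive_lower_ratio x)) (etrans (congr1 (+%R^~ _) (mul0r _)) (add0r _))).
have cz := le_trans cb bz.
have {cE} -> : f b - f a = (c * f c + 1 - Phi z) * (b - a).
  by rewrite !stein_ind_lower// cE; ring.
have := mul_stein_ind_ndecr ac; have := mul_stein_ind_ndecr cb.
by move=> ? ?; apply/andP; split; rewrite ler_wpM2r ?subr_ge0//; lra.
Qed.

Lemma stein_ind_upper_incr a b : a <= b -> z <= a ->
  (a * f a - Phi z) * (b - a) <= f b - f a <= (b * f b - Phi z) * (b - a).
Proof.
move=> ab za; have zb := le_trans za ab.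
have [c /andP[ac cb] cE] := @is_derive_mean_value _
  (fun x => Phi z * upper_ratio x)
  (fun x => Phi z * (x * upper_ratio x - 1)) a b ab
  (fun x _ => is_derive_eq (is_derive_mul (is_derive_const x (Phi z))
    (is_derive_upper_ratio x)) (etrans (congr1 (+%R^~ _) (mul0r _)) (add0r _))).
have zc := le_trans za ac.
have {cE} -> : f b - f a = (c * f c - Phi z) * (b - a).
  by rewrite !stein_ind_upper// cE; ring.
have := mul_stein_ind_ndecr ac; have := mul_stein_ind_ndecr cb.
by move=> ? ?; apply/andP; split; rewrite ler_wpM2r ?subr_ge0//; lra.
Qed.

(** The derivative of [f] away from [z], and its left derivative at [z]. With this choice the Stein
    equation holds at every point, including the kink. *)
Definition stein_ind' x : R := x * f x + (x <= z)%R%:R - Phi z.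
Definition stein_ind_mono x : R := x * f x + 1 - (x <= z)%R%:R - Phi z.

(** On one side of [z] the functions [stein_ind'] and [stein_ind_mono] differ by a constant, and the
    remainder is at most the step times the increment of the derivative. At [z] the derivative drops
    by 1, whereas [stein_ind_mono] rises by 1 and thereby absorbs the jump. *)
Lemma stein_ind_remainder x y :
  `|f x - f y - stein_ind' x * (x - y)| <=
  (x - y) * (stein_ind_mono x - stein_ind_mono y).
Proof.
have u_le := @mul_stein_ind_ndecr; have lo := stein_ind_lower_incr.
have up := stein_ind_upper_incr.
rewrite /stein_ind' /stein_ind_mono ler_norml.
have [xy|/ltW yx] := leP x y.
- have [yz|zy] := leP y z.
    have xz := le_trans xy yz; rewrite xz.
    have /andP[D1 D2] := lo _ _ xy yz; rewrite /=; apply/andP; split; lra.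
  have [xz|zx] := leP x z.
    have /andP[D1 D2] := lo _ _ xz (lexx z).
    have /andP[D3 D4] := up _ _ (ltW zy) (lexx z).
    have uxz := u_le _ _ xz; have uzy := u_le _ _ (ltW zy).
    (* Splitting at [z] leaves cross terms, an increment of [x f x] on one part times the length of
       the other. They are quadratic, so their signs are handed to [lra]. *)
    have p1 : 0 <= (y * f y - z * f z) * (z - x) by rewrite mulr_ge0; lra.
    have p2 : 0 <= (z * f z - x * f x) * (y - z) by rewrite mulr_ge0; lra.
    rewrite /=; apply/andP; split; lra.
  have /andP[D1 D2] := up _ _ xy (ltW zx); rewrite /=; apply/andP; split; lra.
- have [xz|zx] := leP x z.
    have yz := le_trans yx xz; rewrite yz.
    have /andP[D1 D2] := lo _ _ yx xz; rewrite /=; apply/andP; split; lra.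
  have [yz|zy] := leP y z.
    have /andP[D1 D2] := lo _ _ yz (lexx z).
    have /andP[D3 D4] := up _ _ (ltW zx) (lexx z).
    have uyz := u_le _ _ yz; have uzx := u_le _ _ (ltW zx).
    have p1 : 0 <= (x * f x - z * f z) * (z - y) by rewrite mulr_ge0; lra.
    have p2 : 0 <= (z * f z - y * f y) * (x - z) by rewrite mulr_ge0; lra.
    rewrite /=; apply/andP; split; lra.
  have /andP[D1 D2] := up _ _ yx (ltW zy); rewrite /=; apply/andP; split; lra.
Qed.

Lemma stein_ind'_norm_le1 x : `|stein_ind' x| <= 1.
Proof.
have := mul_stein_ind_le x; have := mul_stein_ind_ge x.
rewrite /stein_ind' ler_norml; have := Phi_ge0 z; have := Phi_le1 z.
by case: (x <= z) => /= ????; apply/andP; split; lra.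
Qed.

Lemma stein_ind_mono_norm_le1 x : `|stein_ind_mono x| <= 1.
Proof.
have := mul_stein_ind_le x; have := mul_stein_ind_ge x.
rewrite /stein_ind_mono ler_norml; have := Phi_ge0 z; have := Phi_le1 z.
by case: (x <= z) => /= ????; apply/andP; split; lra.
Qed.

Lemma measurable_ler_cst : measurable_fun setT (fun x : R => x <= z).
Proof. exact: measurable_fun_ler. Qed.

Lemma measurable_stein_ind : measurable_fun setT f.
Proof.
apply: measurable_fun_ifT; first exact: measurable_ler_cst.
  exact: (continuous_measurable_fun (fun x => is_derive_continuous
    (is_derive_mul (is_derive_const x _) (is_derive_lower_ratio x)))).
exact: (continuous_measurable_fun (fun x => is_derive_continuous
  (is_derive_mul (is_derive_const x _) (is_derive_upper_ratio x)))).
Qed.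

Lemma measurable_le_indicator : measurable_fun setT (fun x : R => (x <= z)%R%:R : R).
Proof.
rewrite (_ : (fun _ => _) = (fun x => if x <= z then 1 else 0)).
  exact: measurable_fun_ifT measurable_ler_cst _ _.
by apply/funext => x; case: ifP.
Qed.

Lemma measurable_stein_ind' : measurable_fun setT stein_ind'.
Proof.
apply: measurable_funB => //; apply: measurable_funD.
  by apply: measurable_funM => //; exact: measurable_stein_ind.
exact: measurable_le_indicator.
Qed.

Lemma measurable_stein_ind_mono : measurable_fun setT stein_ind_mono.
Proof.
apply: measurable_funB => //; apply: measurable_funB.
  apply: measurable_funD => //.
  by apply: measurable_funM => //; exact: measurable_stein_ind.
exact: measurable_le_indicator.
Qed.

End fixed_threshold.
End stein_kolmogorov.

(** * The Stein equation for Lipschitz test functions *)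

Section stein_wasserstein.
Context {R : realType}.
Implicit Types (x y z c : R) (k h : R -> R).

(** On either side of [x], [k] is compared with the constant [k x]; centering converts the estimate
    on the right half-line into one for [lower_int]. *)
Lemma lower_int_ndecr_bounds k x : {homo k : x y / x <= y} -> phi_integrable k ->
  gauss_int k = 0 ->
  lower_int k x <= k x * Phi x /\ lower_int k x <= - (k x * (1 - Phi x)).
Proof.
move=> kndecr ik k0; split.
  rewrite -lower_int_cst; apply: lower_int_le => //; first exact: phi_integrable_cst.
  by move=> t; exact: kndecr.
have -> : lower_int k x = - upper_int k x.
  by have := lower_upper_int x ik; rewrite k0; lra.
rewrite lerN2 -upper_int_cst; apply: upper_int_le => //.
  exact: phi_integrable_cst.
by move=> t; exact: kndecr.
Qed.

(* Up to the factor [phi], the derivative is [(1 + x^2) lower_int k x + x k(x) phi x];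
   its sign follows from Mills' inequalities. *)
Lemma mul_stein_nincr k x y : continuous k -> {homo k : x y / x <= y} ->
  phi_integrable k -> gauss_int k = 0 -> x <= y ->
  y * (lower_int k y / phi y) <= x * (lower_int k x / phi x).
Proof.
move=> ck kndecr ik k0 xy.
apply: (@is_derive_nincr _ (fun t => t * (lower_int k t / phi t))
  (fun t => ((1 + t ^+ 2) * lower_int k t + t * phi t * k t) / phi t) _ _ xy) => t _.
  apply: (is_derive_eq (is_derive_mul (is_derive_var t) (is_derive_mul
    (is_derive_lower_int t ck ik) (is_derive_inv (phi_neq0 t) (is_derive_phi t))))).
  by field; exact: phi_neq0.
rewrite -oppr_ge0 -mulNr divr_ge0 ?phi_ge0//.
have [L1 L2] := lower_int_ndecr_bounds t kndecr ik k0.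
have m1 := lower_mills t; have m2 := upper_mills t.
have t2 : 0 < 1 + t ^+ 2 by rewrite ltr_pwDl// sqr_ge0.
(* The sign of [k t] decides which bound on [lower_int k t] combines with a Mills inequality: the
   right tail for [k t >= 0], the left tail otherwise. *)
have [kt|kt] := leP 0 (k t).
  have : (1 + t ^+ 2) * lower_int k t <= (1 + t ^+ 2) * - (k t * (1 - Phi t)).
    by rewrite ler_pM2l.
  have : 0 <= k t * ((1 + t ^+ 2) * (1 - Phi t) - t * phi t) by rewrite mulr_ge0.
  lra.
have : (1 + t ^+ 2) * lower_int k t <= (1 + t ^+ 2) * (k t * Phi t).
  by rewrite ler_pM2l.
have : 0 <= - k t * ((1 + t ^+ 2) * Phi t + t * phi t) by rewrite mulr_ge0 ?oppr_ge0 ?(ltW kt).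
lra.
Qed.

Section fixed_test_function.
Variable h : R -> R.
Hypothesis h_lip : forall x y, `|h x - h y| <= `|x - y|.

Lemma lip_continuous : continuous h.
Proof.
move=> x; apply/cvgrPdist_le => e e0; near=> y.
by apply: (le_trans (h_lip x y)); near: y; exact: cvgr_dist_le.
Unshelve. all: by end_near. Qed.

Lemma lip_phi_integrable : phi_integrable h.
Proof.
apply: (@integrable_lin_phi _ _ `|h 0| 1).
  exact: continuous_measurable_fun lip_continuous.
move=> x; rewrite mul1r -[h x](subrK (h 0)) addrC [leRHS]addrC.
rewrite [in leLHS]addrC (le_trans (ler_normD _ _))// lerD2r.
by rewrite -[leRHS]/(`|x|) -{2}(subr0 x).
Qed.

Let m := gauss_int h.

Lemma phi_integrable_centered : phi_integrable (fun t => h t + - m).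
Proof. exact: phi_integrableD lip_phi_integrable (phi_integrable_cst _). Qed.

Definition stein_lip x : R := lower_int (fun t => h t + - m) x / phi x.
(** Read off from the Stein equation, so that the equation itself needs no proof;
    [is_derive_stein_lip] shows that it is the derivative. *)
Definition stein_lip' x : R := x * stein_lip x + h x - m.

Lemma is_derive_stein_lip x : is_derive x 1 stein_lip (stein_lip' x).
Proof.
have ch : continuous (fun t => h t + - m).
  by move=> t; apply: (@cvgD _ R^o); [exact: lip_continuous|exact: cvg_cst].
apply: (is_derive_eq (is_derive_mul (is_derive_lower_int x ch phi_integrable_centered)
  (is_derive_inv (phi_neq0 x) (is_derive_phi x)))).
by rewrite /stein_lip' /stein_lip; field; exact: phi_neq0.
Qed.

Lemma continuous_stein_lip : continuous stein_lip.
Proof. by move=> x; exact: is_derive_continuous (is_derive_stein_lip x). Qed.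

Lemma continuous_stein_lip' : continuous stein_lip'.
Proof.
move=> x; apply: (@cvgB _ R^o); last exact: cvg_cst.
apply: (@cvgD _ R^o); last exact: lip_continuous.
by apply: cvgM; [exact: cvg_id|exact: continuous_stein_lip].
Qed.

Lemma gauss_int_split x :
  m = lower_int h x + upper_int h x.
Proof. by rewrite lower_upper_int//; exact: lip_phi_integrable. Qed.

(** The left side is the integral of [h t - h x] against [phi] over [t <= x], where the integrand is
    at most [x - t] in absolute value. *)
Lemma lower_int_lip x : `|lower_int h x - h x * Phi x| <= lower_mean x.
Proof.
have i1 := phi_integrableD lip_phi_integrable (phi_integrable_cst (- h x)).
have i2 := phi_integrableD (phi_integrable_cst x)
  (phi_integrableZ (- 1) phi_integrable_id).
have i3 := phi_integrableZ (- 1) i2.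
rewrite -mulNr -lower_int_cst -lower_intD; last 2 first.
- exact: lip_phi_integrable.
- exact: phi_integrable_cst.
rewrite -lower_meanE ler_norml -[- lower_int _ _]mulN1r -lower_intZ//.
apply/andP; split; apply: lower_int_le => // t tx;
  have := h_lip t x; rewrite ler_norml ler0_norm ?subr_le0//;
  by move=> /andP[]; lra.
Qed.

Lemma upper_int_lip x : `|upper_int h x - h x * (1 - Phi x)| <= upper_mean x.
Proof.
have i1 := phi_integrableD lip_phi_integrable (phi_integrable_cst (- h x)).
have i2 := phi_integrableD phi_integrable_id (phi_integrable_cst (- x)).
have i3 := phi_integrableZ (- 1) i2.
rewrite -mulNr -upper_int_cst -upper_intD; last 2 first.
- exact: lip_phi_integrable.
- exact: phi_integrable_cst.
rewrite -upper_meanE ler_norml -[- upper_int _ _]mulN1r -upper_intZ//.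
apply/andP; split; apply: upper_int_le => // t tx;
  have := h_lip t x; rewrite ler_norml ger0_norm ?subr_ge0//;
  by move=> /andP[]; lra.
Qed.

(** Times [phi x], the derivative is a combination of the deviations of [h] from [h x] on the two
    half-lines, each weighted by the mean of the opposite side. Each product is at most [upper_mean
    x * lower_mean x <= phi 0 * phi x]. *)
Lemma stein_lip'_norm_le x : `|stein_lip' x| <= Num.sqrt (2 / pi).
Proof.
rewrite sqrt_2_pi -(ler_pM2r (phi_gt0 x)) -[X in _ * X <= _](ger0_norm (phi_ge0 x)).
rewrite -normrM.
have -> : stein_lip' x * phi x =
    - (lower_mean x * (upper_int h x - h x * (1 - Phi x))) +
    - (upper_mean x * (lower_int h x - h x * Phi x)).
  rewrite /stein_lip' /stein_lip lower_intD ?lower_int_cst; last 2 first.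
  - exact: lip_phi_integrable.
  - exact: phi_integrable_cst.
  rewrite (gauss_int_split x) /lower_mean /upper_mean.
  by field; exact: phi_neq0.
rewrite (le_trans (ler_normD _ _))// !normrN !normrM.
rewrite (ger0_norm (lower_mean_ge0 x)) (ger0_norm (upper_mean_ge0 x)).
have := upper_lower_mean_le x.
have : lower_mean x * `|upper_int h x - h x * (1 - Phi x)| <=
    lower_mean x * upper_mean x.
  by rewrite ler_wpM2l ?lower_mean_ge0 ?upper_int_lip.
have : upper_mean x * `|lower_int h x - h x * Phi x| <=
    upper_mean x * lower_mean x.
  by rewrite ler_wpM2l ?upper_mean_ge0 ?lower_int_lip.
lra.
Qed.

Lemma mul_stein_lip_lip x y : x <= y ->
  `|y * stein_lip y - x * stein_lip x| <= y - x.
Proof.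
move=> xy.
have mono (s : R) : `|s| <= 1 ->
    y * (s * stein_lip y - 1) <= x * (s * stein_lip x - 1).
  move=> s1; have i1 := @phi_integrable_id R.
  have i2 := phi_integrable_centered; have i3 := lip_phi_integrable.
  have i4 := @phi_integrable_cst R (- m); have ii := phi_integrableZ s i2.
  (* Adding the identity makes [k] nondecreasing, as [h] is 1-Lipschitz and [|s| <= 1], and it
     shifts the Stein solution by [- 1]. Then [s = 1] and [s = - 1] give the two sides of the
     bound. *)
  pose k t := s * (h t + - m) + t.
  have kE t : lower_int k t / phi t = s * stein_lip t - 1.
    rewrite /k lower_intD// lower_intZ// lower_int_id.
    by rewrite /stein_lip; field; exact: phi_neq0.
  rewrite -!kE; apply: mul_stein_nincr => //.
  - move=> t; apply: (@cvgD _ R^o); last exact: cvg_id.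
    apply: cvgM; first exact: cvg_cst.
    by apply: (@cvgD _ R^o); [exact: lip_continuous|exact: cvg_cst].
  - move=> a b ab; rewrite /k.
    have := h_lip b a; rewrite (ger0_norm (_ : 0 <= b - a)) ?subr_ge0// => hba.
    have : `|s * (h b - h a)| <= b - a.
      by rewrite normrM (le_trans _ hba)// ler_piMl.
    by rewrite ler_norml => /andP[]; lra.
  - exact: phi_integrableD ii phi_integrable_id.
  - rewrite -(lower_upper_int 0 (phi_integrableD ii i1)).
    rewrite lower_intD// upper_intD// lower_intZ// upper_intZ//.
    rewrite lower_intD// upper_intD// lower_int_cst upper_int_cst.
    rewrite lower_int_id upper_int_id.
    by rewrite (gauss_int_split 0); ring.
have := mono 1; have := mono (- 1); rewrite normrN normr1 => /(_ (lexx 1)) ?.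
move=> /(_ (lexx 1)) ?; rewrite ler_norml; apply/andP; split; lra.
Qed.

(** One unit of the constant comes from [x * stein_lip x], the other from [h]. *)
Lemma stein_lip'_lip x y : x <= y -> `|stein_lip' y - stein_lip' x| <= 2 * (y - x).
Proof.
move=> xy; rewrite /stein_lip'.
have := mul_stein_lip_lip xy; have := h_lip y x.
rewrite (ger0_norm (_ : 0 <= y - x)) ?subr_ge0// !ler_norml.
by move=> /andP[? ?] /andP[? ?]; apply/andP; split; lra.
Qed.

Lemma stein_lip_remainder x y :
  `|stein_lip x - stein_lip y - stein_lip' x * (x - y)| <= (x - y) ^+ 2.
Proof.
(* The remainder plus a parabola, vanishing at [t = x]. Since the derivative is 2-Lipschitz, [p 1]
   has its minimum and [p (- 1)] its maximum there. *)
pose p (s t : R) := stein_lip t - stein_lip x - stein_lip' x * (t - x) + s * (t - x) ^+ 2.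
pose p' (s t : R) := stein_lip' t - stein_lip' x + s * (2 * (t - x)).
have dp (s t : R) : is_derive t 1 (p s) (p' s t).
  have -> : p s = (fun t => stein_lip t - stein_lip x - stein_lip' x * (t - x) +
      s * ((t - x) * (t - x))) by apply/funext => r; rewrite /p expr2.
  have dtx := is_derive_add (is_derive_var t) (is_derive_const t (- x)).
  apply: (is_derive_eq (is_derive_add (is_derive_add (is_derive_add
    (is_derive_stein_lip t) (is_derive_const t (- stein_lip x)))
    (is_derive_opp (is_derive_mul (is_derive_const t (stein_lip' x)) dtx)))
    (is_derive_mul (is_derive_const t s) (is_derive_mul dtx dtx)))).
  by rewrite /p'; ring.
have p0 s : p s x = 0 by rewrite /p; ring.
suff [p1 p2] : p (- 1) y <= 0 /\ 0 <= p 1 y.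
  rewrite ler_norml; move: p1 p2; rewrite /p => p1 p2; apply/andP; split; lra.
have [xy|/ltW yx] := leP x y.
- split.
    rewrite -(p0 (- 1)).
    apply: (is_derive_nincr xy (fun t _ => dp (- 1) t)) => t /andP[xt _].
    by have := stein_lip'_lip xt; rewrite /p' ler_norml => /andP[]; lra.
  rewrite -(p0 1).
  apply: (is_derive_ndecr xy (fun t _ => dp 1 t)) => t /andP[xt _].
  by have := stein_lip'_lip xt; rewrite /p' ler_norml => /andP[]; lra.
- split.
    rewrite -(p0 (- 1)).
    apply: (is_derive_ndecr yx (fun t _ => dp (- 1) t)) => t /andP[_ tx].
    by have := stein_lip'_lip tx; rewrite /p' ler_norml => /andP[]; lra.
  rewrite -(p0 1).
  apply: (is_derive_nincr yx (fun t _ => dp 1 t)) => t /andP[_ tx].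
  by have := stein_lip'_lip tx; rewrite /p' ler_norml => /andP[]; lra.
Qed.

End fixed_test_function.
End stein_wasserstein.

(** * Integration against the standard normal law *)

Section standard_normal_expectation.
Context {R : realType}.
Notation mu := (@lebesgue_measure R).
Implicit Types h : R -> R.

Lemma ge0_integral_normal_prob h : measurable_fun [set: R] h -> (forall x, 0 <= h x) ->
  (\int[normal_prob 0 1]_x (h x)%:E = \int[mu]_x (h x * phi x)%:E)%E.
Proof.
move=> mh h0; have dom := @normal_prob_dominates R 0 1.
pose g := Radon_Nikodym_SigmaFinite.f (normal_prob (0 : R) 1) mu.
have ig : mu.-integrable [set: R] g := Radon_Nikodym_SigmaFinite.f_integrable dom.
have mphi : measurable_fun [set: R] (EFin \o (phi : R -> R)).
  by apply/measurable_EFinP; exact: measurable_phi.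
have mhE : measurable_fun [set: R] (EFin \o h) by exact/measurable_EFinP.
rewrite -(@Radon_Nikodym_SigmaFinite.change_of_variables _ _ _ _ mu dom (EFin \o h))//.
transitivity (\int[mu]_x ((h x)%:E * (phi x)%:E))%E; last first.
  by apply: eq_integral => x _; rewrite EFinM.
apply: ae_eq_integral => //.
- by apply: emeasurable_funM => //; exact: measurable_int ig.
- exact: emeasurable_funM.
(* The Radon-Nikodym density of the normal law and [phi] have the same integral over every
   measurable set, hence agree almost everywhere. *)
- apply: ae_eqe_mul2l; apply: integral_ae_eq => // A _ mA.
  by rewrite -Radon_Nikodym_SigmaFinite.f_integral.
Qed.

Section expectation.
Context d (T : measurableType d) (P : probability T R) (Z : {RV P >-> R}).
Hypothesis stdZ : standard_normal Z.

Lemma ge0_integral_standard_normal h : measurable_fun [set: R] h -> (forall x, 0 <= h x) ->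
  (\int[P]_w (h (Z w))%:E = \int[mu]_x (h x * phi x)%:E)%E.
Proof.
move=> mh h0; rewrite -ge0_integral_normal_prob//.
have mZ : measurable_fun [set: T] (Z : T -> measurableTypeR R).
  by move=> _ A mA; exact: measurable_funP.
pose mixZ := isMeasurableFun.Build _ _ T (measurableTypeR R) _ mZ.
pose Z' : {mfun T >-> measurableTypeR R} := HB.pack (Z : T -> measurableTypeR R) mixZ.
have mhE : measurable_fun [set: measurableTypeR R] (EFin \o h) by exact/measurable_EFinP.
have hE0 (x : measurableTypeR R) : (0 <= (EFin \o h) x)%E by rewrite lee_fin.
rewrite -[LHS](@ge0_integral_distribution _ _ _ _ _ P Z' (EFin \o h) mhE hE0).
by apply: (eq_measure_integral (normal_prob 0 1)) => A mA _; exact: stdZ.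
Qed.

Lemma expectation_standard_normal h : measurable_fun [set: R] h -> phi_integrable h ->
  ('E_P[h \o Z] = (gauss_int h)%:E)%E.
Proof.
move=> mh ih; rewrite unlock.
have mn : measurable_fun [set: R] (fun x => `|h x|) by exact: measurableT_comp.
have mp : measurable_fun [set: R] (fun x => `|h x| + h x) by exact: measurable_funD.
have n0 x : 0 <= `|h x| by [].
have p0 x : 0 <= `|h x| + h x.
  by rewrite -lerBlDr sub0r -normrN ler_norm.
have inh : phi_integrable (fun x => `|h x|).
  apply: eq_integrable (integrable_norm ih) => // x _ /=.
  by rewrite normrM (ger0_norm (phi_ge0 _)).
have iph := phi_integrableD inh ih.
have gE (k : R -> R) : measurable_fun [set: R] k -> (forall x, 0 <= k x) -> phi_integrable k ->
    (\int[P]_w (k (Z w))%:E = (gauss_int k)%:E)%E.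
  move=> mk k0 ik; rewrite ge0_integral_standard_normal// /gauss_int /Rintegral fineK//.
  exact: integrable_fin_num.
have iP (k : R -> R) : measurable_fun [set: R] k -> (forall x, 0 <= k x) -> phi_integrable k ->
    P.-integrable [set: T] (EFin \o (k \o Z)).
  move=> mk k0 ik; apply/integrableP; split.
    by apply/measurable_EFinP; exact: measurableT_comp.
  rewrite (eq_integral (fun w => (k (Z w))%:E)) ?gE ?ltry// => w _.
  by rewrite /= ger0_norm.
(* The formula for nonnegative functions is applied to both parts of [h = (|h| + h) - |h|]. *)
transitivity (\int[P]_w ((`|h (Z w)| + h (Z w))%:E - (`|h (Z w)|)%:E))%E.
  by apply: eq_integral => w _; rewrite -EFinB addrAC subrr add0r.
rewrite integralB//; [|exact: iP _ mp p0 iph|exact: iP _ mn n0 inh].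
rewrite (gE _ mp p0 iph) (gE _ mn n0 inh) -EFinB; congr EFin.
rewrite /gauss_int -RintegralB//.
by apply: eq_Rintegral => x _; ring.
Qed.

Lemma cdf_standard_normal z : cdf Z z = (Phi z)%:E.
Proof.
rewrite /cdf stdZ// /normal_prob /Phi /lower_int /Rintegral.
under [in RHS]eq_integral do rewrite mul1r.
rewrite fineK//; apply: integrable_fin_num => //.
by apply: integrableS integrable_phi.
Qed.

End expectation.
End standard_normal_expectation.

(** * Square integrable functions and conditional expectations *)

Section square_integrable.
Context d (T : measurableType d) (R : realType) (P : probability T R).
Implicit Types f g h : T -> R.

Definition integrableR f := P.-integrable [set: T] (EFin \o f).

Definition sq_integrable f :=
  measurable_fun [set: T] f /\ integrableR (fun w => f w ^+ 2).

Definition Ex f : R := \int[P]_w f w.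

Lemma integrableR_measurable f : integrableR f -> measurable_fun [set: T] f.
Proof. by move=> /measurable_int /measurable_EFinP. Qed.

Lemma integrableRS (A : set T) f : measurable A -> integrableR f ->
  P.-integrable A (EFin \o f).
Proof. by move=> mA; apply: integrableS. Qed.

Lemma le_integrableR f g : measurable_fun [set: T] f ->
  (forall w, `|f w| <= `|g w|) -> integrableR g -> integrableR f.
Proof.
move=> mf fg; apply: le_integrable => //; first exact/measurable_EFinP.
by move=> w _ /=; rewrite lee_fin.
Qed.

Lemma integrableRD f g : integrableR f -> integrableR g -> integrableR (fun w => f w + g w).
Proof.
by move=> sf sg; apply: eq_integrable (integrableD _ sf sg).
Qed.

Lemma integrableRZ c f : integrableR f -> integrableR (fun w => c * f w).
Proof.
by move=> sf; apply: eq_integrable (integrableZl _ c sf).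
Qed.

Lemma integrableRN f : integrableR f -> integrableR (fun w => - f w).
Proof.
by move=> /(integrableRZ (- 1)); apply: eq_integrable => // w _; rewrite /= mulN1r.
Qed.

Lemma integrableRB f g : integrableR f -> integrableR g -> integrableR (fun w => f w - g w).
Proof. by move=> sf /integrableRN; exact: integrableRD. Qed.

Lemma integrableR_cst c : integrableR (fun=> c).
Proof. exact: finite_measure_integrable_cst. Qed.

Lemma integrableR_norm f : integrableR f -> integrableR (fun w => `|f w|).
Proof. exact: integrable_norm. Qed.

Lemma integrableR_sum (I : Type) (s : seq I) (f : I -> T -> R) :
  (forall i, integrableR (f i)) -> integrableR (fun w => \sum_(i <- s) f i w).
Proof.
move=> sf; elim: s => [|i s IH].
  by apply: eq_integrable (integrableR_cst 0) => // w _; rewrite /= big_nil.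
apply: eq_integrable (integrableRD (sf i) IH) => // w _.
by rewrite /= big_cons.
Qed.

Lemma ExD f g : integrableR f -> integrableR g -> Ex (fun w => f w + g w) = Ex f + Ex g.
Proof. by move=> sf sg; rewrite /Ex RintegralD. Qed.

Lemma ExB f g : integrableR f -> integrableR g -> Ex (fun w => f w - g w) = Ex f - Ex g.
Proof. by move=> sf sg; rewrite /Ex RintegralB. Qed.

Lemma ExZ c f : integrableR f -> Ex (fun w => c * f w) = c * Ex f.
Proof. by move=> sf; rewrite /Ex RintegralZl. Qed.

Lemma Ex_cst c : Ex (fun=> c) = c.
Proof. by rewrite /Ex Rintegral_cst//= probability_setT mulr1. Qed.

Lemma Ex_sum (I : Type) (s : seq I) (f : I -> T -> R) :
  (forall i, integrableR (f i)) ->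
  Ex (fun w => \sum_(i <- s) f i w) = \sum_(i <- s) Ex (f i).
Proof.
move=> sf; elim: s => [|i s IH].
  by rewrite big_nil -[RHS](Ex_cst 0); apply: eq_Rintegral => w _; rewrite big_nil.
rewrite big_cons -IH -ExD//; last exact: integrableR_sum.
by apply: eq_Rintegral => w _; rewrite big_cons.
Qed.

Lemma Ex_ge0 f : (forall w, 0 <= f w) -> 0 <= Ex f.
Proof. by move=> f0; exact: Rintegral_ge0. Qed.

Lemma Ex_le f g : integrableR f -> integrableR g -> (forall w, f w <= g w) ->
  Ex f <= Ex g.
Proof. by move=> sf sg fg; exact: le_Rintegral. Qed.

Lemma Ex_norm f : integrableR f -> `|Ex f| <= Ex (fun w => `|f w|).
Proof. by move=> sf; exact: le_normr_Rintegral. Qed.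

Lemma ExE f : integrableR f -> (\int[P]_w (f w)%:E = (Ex f)%:E)%E.
Proof. by move=> sf; rewrite /Ex /Rintegral fineK// integrable_fin_num. Qed.

Lemma sq_integrableM f g : sq_integrable f -> sq_integrable g ->
  integrableR (fun w => f w * g w).
Proof.
move=> [mf sf] [mg sg]; apply: le_integrableR (integrableRD sf sg).
  exact: measurable_funM.
move=> w; rewrite (ger0_norm (addr_ge0 (sqr_ge0 _) (sqr_ge0 _))) normrM.
rewrite -(real_normK (num_real (f w))) -(real_normK (num_real (g w))).
have := sqr_ge0 (`|f w| - `|g w|); have := sqr_ge0 `|f w|.
have := sqr_ge0 `|g w|; rewrite !expr2; nra.
Qed.

Lemma le_sq_integrable f g : measurable_fun [set: T] f ->
  (forall w, `|f w| <= `|g w|) -> sq_integrable g -> sq_integrable f.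
Proof.
move=> mf fg [mg sg]; split => //; apply: le_integrableR sg.
  exact: measurable_funX.
by move=> w; rewrite !normrX lerXn2r// nnegrE.
Qed.

Lemma sq_integrable_cst c : sq_integrable (fun=> c).
Proof. by split; [exact: measurable_cst|exact: integrableR_cst]. Qed.

Lemma sq_integrableW f : sq_integrable f -> integrableR f.
Proof.
move=> sf; have := sq_integrableM sf (sq_integrable_cst 1).
by apply: eq_integrable => // w _; rewrite /= mulr1.
Qed.

Lemma sq_integrableZ c f : sq_integrable f -> sq_integrable (fun w => c * f w).
Proof.
move=> [mf sf]; split; first exact: measurable_funM.
apply: eq_integrable (integrableRZ (c ^+ 2) sf) => // w _.
by rewrite /= exprMn.
Qed.

Lemma sq_integrableD f g : sq_integrable f -> sq_integrable g ->
  sq_integrable (fun w => f w + g w).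
Proof.
move=> sf sg; split; first exact: measurable_funD sf.1 sg.1.
apply: eq_integrable (integrableRD (integrableRD sf.2 sg.2)
  (integrableRZ 2 (sq_integrableM sf sg))) => // w _ /=.
by congr EFin; ring.
Qed.

Lemma sq_integrableB f g : sq_integrable f -> sq_integrable g ->
  sq_integrable (fun w => f w - g w).
Proof.
move=> sf sg; have [mB sB] := sq_integrableD sf (sq_integrableZ (- 1) sg).
split; first exact: measurable_funB sf.1 sg.1.
by apply: eq_integrable sB => // w _; rewrite /= mulN1r.
Qed.

Lemma sq_integrable_norm f : sq_integrable f -> sq_integrable (fun w => `|f w|).
Proof.
move=> [mf sf]; split; first exact: measurableT_comp.
by apply: eq_integrable sf => // w _; rewrite /= real_normK ?num_real.
Qed.

Lemma sq_integrable_bounded c f g : measurable_fun [set: T] g ->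
  (forall w, `|g w| <= c) -> sq_integrable f -> sq_integrable (fun w => f w * g w).
Proof.
move=> mg gc sf; apply: le_sq_integrable (sq_integrableZ c sf).
  exact: measurable_funM sf.1 mg.
move=> w; rewrite !normrM mulrC ler_wpM2r//.
exact: le_trans (gc w) (ler_norm _).
Qed.

(* Cauchy-Schwarz in additive form. *)
Lemma Ex_normM_le (c : R) f g : 0 < c -> sq_integrable f -> sq_integrable g ->
  Ex (fun w => `|f w * g w|) <=
  c * Ex (fun w => f w ^+ 2) + c^-1 * Ex (fun w => g w ^+ 2).
Proof.
move=> c0 sf sg; rewrite -ExZ ?sf.2// -ExZ; last exact: sg.2.
rewrite -ExD; [|exact: (integrableRZ _ sf.2)|exact: (integrableRZ _ sg.2)].
apply: Ex_le.
- exact: integrableR_norm (sq_integrableM sf sg).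
- exact: integrableRD (integrableRZ _ sf.2) (integrableRZ _ sg.2).
move=> w; rewrite normrM.
rewrite -(real_normK (num_real (f w))) -(real_normK (num_real (g w))).
have : 0 <= c^-1 * (c * `|f w| - `|g w|) ^+ 2.
  by rewrite mulr_ge0 ?sqr_ge0// invr_ge0 ltW.
have -> : c^-1 * (c * `|f w| - `|g w|) ^+ 2 =
    c * `|f w| ^+ 2 - 2 * (`|f w| * `|g w|) + c^-1 * `|g w| ^+ 2.
  by field; rewrite gt_eqF.
have : 0 <= `|f w| * `|g w| by rewrite mulr_ge0.
lra.
Qed.

Lemma Ex_sqr0_ae f : sq_integrable f -> Ex (fun w => f w ^+ 2) = 0 ->
  {ae P, forall w, f w = 0}.
Proof.
move=> sf Ef0.
have : (\int[P]_w `|(f w ^+ 2)%:E| = 0)%E.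
  transitivity (\int[P]_w (f w ^+ 2)%:E)%E.
    by apply: eq_integral => w _; rewrite gee0_abs// lee_fin sqr_ge0.
  by rewrite ExE ?Ef0//; exact: sf.2.
have mf2 : measurable_fun [set: T] (fun w => (f w ^+ 2)%:E).
  by apply/measurable_EFinP; exact: integrableR_measurable sf.2.
move=> /(ae_eq_integral_abs _ measurableT mf2); apply: filterS => w /(_ I) [].
by move/eqP; rewrite sqrf_eq0 => /eqP.
Qed.

Lemma Ex_ae_eq f g : integrableR f -> integrableR g ->
  {ae P, forall w, f w = g w} -> Ex f = Ex g.
Proof.
move=> sf sg fg; rewrite /Ex /Rintegral; congr fine.
apply: ae_eq_integral => //.
- exact: (measurable_int P sf).
- exact: (measurable_int P sg).
- by apply: filterS fg => w fg _; rewrite /= fg.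
Qed.

End square_integrable.

(** * Conditional expectation as an orthogonal projection *)

Section conditional_expectation.
Context d (T : measurableType d) (R : realType) (P : probability T R).
Variable G : set (set T).
Hypothesis sub : <<s G >> `<=` (@measurable _ T).
Notation TG := (g_sigma_algebraType G).
Implicit Types F Y W Z : T -> R.

Definition G_measurable Y := measurable_fun [set: TG] Y.

Definition to_G : T -> TG := id.

Lemma measurable_to_G : measurable_fun [set: T] to_G.
Proof. by move=> _ A mA; rewrite setTI; exact: sub. Qed.

Lemma G_measurableW Y : G_measurable Y -> measurable_fun [set: T] Y.
Proof.
by move=> mY; exact: (measurableT_comp (f := (Y : TG -> R)) mY measurable_to_G).
Qed.

HB.instance Definition _ :=
  isMeasurableFun.Build _ _ T TG to_G measurable_to_G.

Let PG : probability TG R := distribution P to_G.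

Section existence.
Variable F : T -> R.
Hypothesis sF : integrableR P F.

Let nu : set TG -> \bar R := fun A => (\int[P]_(w in A) (F w)%:E)%E.

Let nu0 : nu set0 = 0%E. Proof. exact: integral_set0. Qed.

Let nufin A : measurable A -> nu A \is a fin_num.
Proof.
move=> mA; apply: integrable_fin_num; first exact: sub.
by apply: integrableS sF => //; exact: sub.
Qed.

Let nu_add : semi_sigma_additive nu.
Proof.
move=> A mA tA mUA.
apply: (charge_semi_sigma_additive (s := induced_charge sF)).
- by move=> i; apply: sub; exact: mA.
- exact: tA.
- exact: sub mUA.
Qed.

HB.instance Definition _ := isCharge.Build _ _ _ nu nu0 nufin nu_add.

(** The version is the Radon-Nikodym derivative of the charge [nu] with respect to [PG], the
    restriction of [P] to the sigma-algebra; [fine] makes it real-valued. *)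
Lemma is_cexp_exists : exists Y, is_cexp P G F Y.
Proof.
have dom : nu `<< PG.
  apply/null_content_dominatesP => A mA PA0.
  apply: null_set_integral => //; first exact: sub.
  by apply: measurable_funTS; exact: (measurable_int P sF).
have iRN := Radon_Nikodym_integrable dom.
have RNfin w := @Radon_Nikodym_fin_num _ _ _ nu PG w dom.
have RNE A := @Radon_Nikodym_integral _ _ _ nu PG A dom.
pose Y : TG -> R := fine \o Radon_Nikodym nu PG.
have YE : EFin \o Y = Radon_Nikodym nu PG.
  by apply/funext => w; rewrite /= fineK.
have mY : measurable_fun [set: TG] (EFin \o Y) by rewrite YE; exact: measurable_int iRN.
have iY : P.-integrable [set: T] (EFin \o Y).
  move/integrableP : iRN; rewrite -YE => -[_ Yoo]; apply/integrableP; split.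
    by apply/measurable_EFinP; apply: G_measurableW; exact/measurable_EFinP.
  move: Yoo; rewrite ge0_integral_pushforward//.
  exact: measurableT_comp.
exists Y; split => //; first exact/measurable_EFinP.
move=> A mA; rewrite -[RHS]/(nu A) RNE// -YE integral_pushforward//.
by apply: (integrableS measurableT) iY => //; exact: sub.
Qed.
End existence.

Lemma integral_nnsfunM (h : {nnsfun TG >-> R}) (W : T -> \bar R) :
  measurable_fun [set: T] W -> (forall w, 0 <= W w)%E ->
  (\int[P]_w ((h w)%:E * W w) =
   \sum_(r \in range h) (r%:E * \int[P]_(w in h @^-1` [set r]) W w))%E.
Proof.
move=> mW W0.
have mh r : measurable (h @^-1` [set r] : set T).
  by apply: sub; exact: (measurable_sfunP h (measurable_set1 r)).
have mi r : measurable_fun [set: T] (fun w => (r * \1_(h @^-1` [set r]) w)%:E).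
  by apply/measurable_EFinP; apply: measurable_funM => //; exact: measurable_indic.
transitivity (\int[P]_w (\sum_(r \in range h)
    ((r * \1_(h @^-1` [set r]) w)%:E * W w)))%E.
  apply: eq_integral => w _.
  rewrite -ge0_mule_fsuml => [|r]; last exact: nnfun_muleindic_ge0.
  by rewrite fsumEFin// {1}(fimfunE h w).
rewrite ge0_integral_fsum//; last 2 first.
- by move=> r; exact: emeasurable_funM.
- by move=> r w _; rewrite mule_ge0// nnfun_muleindic_ge0.
apply: eq_fsbigr => r rh.
have r0 : 0 <= r by move: rh; rewrite inE => -[w _ <-].
under eq_integral do rewrite EFinM -muleA.
rewrite ge0_integralZl//.
- congr (_ * _)%E; rewrite [RHS]integral_mkcond; apply: eq_integral => w _.
  by rewrite muleC epatch_indic.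
- apply: emeasurable_funM => //; apply/measurable_EFinP.
  exact: measurable_indic.
- by move=> w _; rewrite mule_ge0// lee_fin.
Qed.

(** The level sets of a simple [Z] belong to [<<s G>>], where the integrals agree; monotone
    convergence does the rest. Nonnegativity dispenses with integrability of the products. *)
Lemma ge0_pull_out (W1 W2 Z : T -> R) :
  measurable_fun [set: T] W1 -> measurable_fun [set: T] W2 ->
  (forall w, 0 <= W1 w) -> (forall w, 0 <= W2 w) ->
  (forall A, <<s G >> A ->
    \int[P]_(w in A) (W1 w)%:E = \int[P]_(w in A) (W2 w)%:E)%E ->
  G_measurable Z -> (forall w, 0 <= Z w) ->
  (\int[P]_w (Z w * W1 w)%:E = \int[P]_w (Z w * W2 w)%:E)%E.
Proof.
move=> mW1 mW2 W10 W20 W12 mZ Z0.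
have mEZ : measurable_fun [set: TG] (EFin \o Z) by exact/measurable_EFinP.
pose h := nnsfun_approx measurableT mEZ.
have cv W : measurable_fun [set: T] W -> (forall w, 0 <= W w) ->
    (\int[P]_w ((h n w)%:E * (W w)%:E) @[n --> \oo] -->
     \int[P]_w (Z w * W w)%:E)%E.
  move=> mW W0.
  have ZE w : ((Z w * W w)%:E = limn (fun n => (h n w)%:E * (W w)%:E))%E.
    apply/esym/cvg_lim => //; rewrite EFinM; apply: cvgeZr => //.
    by apply: (@cvg_nnsfun_approx _ TG _ _ measurableT _ mEZ) => // x _; rewrite lee_fin.
  rewrite [X in _ --> X](_ : _ = \int[P]_w limn (fun n => (h n w)%:E * (W w)%:E))%E; last first.
    by apply: eq_integral => w _.
  apply: cvg_monotone_convergence => //.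
  - move=> n; apply: emeasurable_funM; apply/measurable_EFinP => //.
    by apply: G_measurableW; exact: measurable_funP.
  - by move=> n w _; rewrite mule_ge0// lee_fin.
  - move=> w _ a b ab; rewrite lee_wpmul2r ?lee_fin//.
    by have /lefP := @nd_nnsfun_approx _ TG R _ measurableT _ mEZ _ _ ab; exact.
have := cv _ mW1 W10; have := cv _ mW2 W20.
have -> : (fun n => \int[P]_w ((h n w)%:E * (W1 w)%:E))%E =
          (fun n => \int[P]_w ((h n w)%:E * (W2 w)%:E))%E.
  apply/funext => n.
  rewrite (integral_nnsfunM (h n) (W := EFin \o W1)) ?(integral_nnsfunM (h n) (W := EFin \o W2)).
  - apply: eq_fsbigr => r _; rewrite /= W12//.
    exact: (measurable_sfunP (h n) (measurable_set1 r)).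
  - exact/measurable_EFinP.
  - by move=> w; rewrite lee_fin.
  - exact/measurable_EFinP.
  - by move=> w; rewrite lee_fin.
by move=> /cvg_lim <-// /cvg_lim <-.
Qed.

Lemma integral_setB (A : set T) f g : measurable A -> integrableR P f -> integrableR P g ->
  (\int[P]_(w in A) f w = \int[P]_(w in A) g w) ->
  (\int[P]_(w in A) (f w)%:E = \int[P]_(w in A) (g w)%:E)%E.
Proof.
move=> mA sf sg fg; have := congr1 EFin fg.
by rewrite /Rintegral !fineK//; apply: integrable_fin_num => //; exact: integrableRS.
Qed.

(** As [W] integrates to zero over each set of [<<s G>>], its positive and negative parts have equal
    integrals there and [ge0_pull_out] compares them. [Z] is split into its two parts as well. *)
Lemma pull_out W Z : integrableR P W ->
  (forall A, <<s G >> A -> \int[P]_(w in A) W w = 0) ->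
  G_measurable Z -> integrableR P (fun w => Z w * W w) ->
  Ex P (fun w => Z w * W w) = 0.
Proof.
move=> sW W0 mZ sZW.
pose pos (f : T -> R) w := 2^-1 * (`|f w| + f w).
pose neg (f : T -> R) w := 2^-1 * (`|f w| - f w).
have pos0 f w : 0 <= pos f w.
  by rewrite mulr_ge0// -lerBlDr sub0r -normrN ler_norm.
have neg0 f w : 0 <= neg f w by rewrite mulr_ge0// subr_ge0 ler_norm.
have pos_le f w : `|pos f w| <= `|f w|.
  by rewrite ger0_norm// /pos; have := ler_norm (f w); lra.
have neg_le f w : `|neg f w| <= `|f w|.
  by rewrite ger0_norm// /neg; have := ler_norm (- f w); rewrite normrN; lra.
have pB f w : f w = pos f w - neg f w by rewrite /pos /neg; field.
have mpos d' (U : measurableType d') (f : U -> R) : measurable_fun setT f ->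
    measurable_fun setT (fun w => 2^-1 * (`|f w| + f w)).
  by move=> mf; apply: measurable_funM => //; apply: measurable_funD => //;
    exact: measurableT_comp.
have mneg d' (U : measurableType d') (f : U -> R) : measurable_fun setT f ->
    measurable_fun setT (fun w => 2^-1 * (`|f w| - f w)).
  by move=> mf; apply: measurable_funM => //; apply: measurable_funB => //;
    exact: measurableT_comp.
have mW := integrableR_measurable sW.
have spW : integrableR P (pos W).
  by apply: le_integrableR sW => //; exact: mpos.
have snW : integrableR P (neg W).
  by apply: le_integrableR sW => //; exact: mneg.
have key V : G_measurable V -> (forall w, 0 <= V w) ->
    (forall w, `|V w| <= `|Z w|) -> Ex P (fun w => V w * W w) = 0.
  move=> mV V0 VZ.
  have mV' := G_measurableW mV.
  have sV (f : T -> R) : measurable_fun setT f -> (forall w, `|f w| <= `|W w|) ->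
      integrableR P (fun w => V w * f w).
    move=> mf fW; apply: le_integrableR sZW; first exact: measurable_funM.
    by move=> w; rewrite !normrM ler_pM.
  have spV := sV _ (mpos _ _ _ mW) (pos_le W).
  have snV := sV _ (mneg _ _ _ mW) (neg_le W).
  transitivity (Ex P (fun w => V w * pos W w) - Ex P (fun w => V w * neg W w)).
    rewrite -ExB//; congr (Ex P); apply/funext => w.
    by rewrite -mulrBr -pB.
  apply/eqP; rewrite subr_eq0; apply/eqP; rewrite /Ex /Rintegral; congr fine.
  apply: ge0_pull_out => //; [exact: mpos|exact: mneg|].
  move=> A GA; have mA := sub GA; apply: integral_setB => //.
  apply/eqP; rewrite -subr_eq0 -RintegralB//.
  - by rewrite -[X in _ == X](W0 _ GA); apply/eqP; apply: eq_Rintegral => w _; rewrite -pB.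
  - exact: integrableRS spW.
  - exact: integrableRS snW.
have -> : (fun w => Z w * W w) = (fun w => pos Z w * W w - neg Z w * W w).
  by apply/funext => w; rewrite -mulrBl -pB.
have mpZ : G_measurable (pos Z) by exact: mpos.
have mnZ : G_measurable (neg Z) by exact: mneg.
rewrite ExB.
- by rewrite !key ?subrr.
- apply: le_integrableR sZW; first by apply: measurable_funM => //; exact: G_measurableW.
  by move=> w; rewrite normrM (normrM (Z w)) ler_wpM2r ?pos_le.
- apply: le_integrableR sZW; first by apply: measurable_funM => //; exact: G_measurableW.
  by move=> w; rewrite normrM (normrM (Z w)) ler_wpM2r ?neg_le.
Qed.

Lemma cexpP F : integrableR P F -> is_cexp P G F (cexp P G F).
Proof. by move=> /is_cexp_exists[Y GY]; rewrite /cexp; case: xgetP => // /(_ _ GY). Qed.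

Lemma is_cexp_defect F Y A : integrableR P F -> is_cexp P G F Y -> <<s G >> A ->
  \int[P]_(w in A) (F w - Y w) = 0.
Proof.
move=> sF [_ sY YF] GA; have mA := sub GA.
rewrite RintegralB//; try exact: integrableRS.
by rewrite /Rintegral YF// subrr.
Qed.

(* The truncations [Z = Y 1_{|Y| <= n}] satisfy [E Z^2 = E Z F <= (E Z^2 + E F^2) / 2]. *)
Lemma is_cexp_contraction F Y : sq_integrable P F -> is_cexp P G F Y ->
  sq_integrable P Y /\ Ex P (fun w => Y w ^+ 2) <= Ex P (fun w => F w ^+ 2).
Proof.
move=> sF FY; have [mY sY _] := FY; have mY' := G_measurableW mY.
pose Z n w : R := if `|Y w| <= n%:R then Y w else 0.
have mZ n : G_measurable (Z n).
  apply: measurable_fun_ifT => //; apply: measurable_fun_ler => //.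
  exact: measurableT_comp.
have Zn n w : `|Z n w| <= n%:R by rewrite /Z; case: ifP => //; rewrite normr0.
have mZ' n := G_measurableW (mZ n).
have bZ n f : integrableR P f -> integrableR P (fun w => Z n w * f w).
  move=> sf; apply: le_integrableR (integrableRZ n%:R sf).
    by apply: measurable_funM => //; exact: (integrableR_measurable sf).
  by move=> w; rewrite normrM (normrM n%:R) ler_wpM2r// (le_trans (Zn _ _))// ler_norm.
have sF1 := sq_integrableW sF.
have sZ2 n : integrableR P (fun w => Z n w ^+ 2).
  apply: le_integrableR (integrableR_cst P (n%:R ^+ 2)).
    exact: measurable_funX.
  by move=> w; rewrite !normrX lerXn2r ?nnegrE//; apply: le_trans (Zn n w) (ler_norm _).
have EZ n : Ex P (fun w => Z n w ^+ 2) <= Ex P (fun w => F w ^+ 2).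
  have /esym := pull_out (integrableRB sF1 sY) (fun A => is_cexp_defect sF1 FY)
    (mZ n) (bZ n _ (integrableRB sF1 sY)).
  have -> : (fun w => Z n w * (F w - Y w)) = (fun w => Z n w * F w - Z n w ^+ 2).
    by apply/funext => w; rewrite /Z; case: ifP => _; ring.
  rewrite ExB//; last exact: bZ.
  suff : Ex P (fun w => Z n w * F w) <=
      2^-1 * Ex P (fun w => Z n w ^+ 2) + 2^-1 * Ex P (fun w => F w ^+ 2) by lra.
  rewrite -!ExZ//; last exact: sF.2.
  rewrite -ExD; [|exact: integrableRZ|exact: (integrableRZ _ sF.2)].
  apply: Ex_le; first exact: bZ.
    exact: integrableRD (integrableRZ _ (sZ2 n)) (integrableRZ _ sF.2).
  by move=> w; have := sqr_ge0 (Z n w - F w); rewrite !expr2; lra.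
have mY2 : measurable_fun setT (EFin \o (fun w => Y w ^+ 2)).
  by apply/measurable_EFinP; exact: measurable_funX.
(* [Y] is only known to be integrable, so the uniform bound on the truncations is carried over to
   [Y ^+ 2] by monotone convergence. *)
have lim_le : (\int[P]_w (Y w ^+ 2)%:E <= (Ex P (fun w => F w ^+ 2))%:E)%E.
  have cZ w : (((Z n w) ^+ 2)%:E @[n --> \oo] --> (Y w ^+ 2)%:E)%E.
    apply: cvg_near_cst; near=> n; rewrite /Z ifT//.
    near: n; exists (Num.truncn `|Y w|).+1 => // n /= nY.
    by rewrite (le_trans (ltW (truncnS_gt _)))// ler_nat.
  have -> : (\int[P]_w (Y w ^+ 2)%:E = \int[P]_w limn (fun n => ((Z n w) ^+ 2)%:E))%E.
    by apply: eq_integral => w _; apply/esym/cvg_lim => //; exact: cZ.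
  rewrite monotone_convergence//.
  - apply: lime_le.
    + apply: ereal_nondecreasing_is_cvgn => a b ab; apply: ge0_le_integral => //.
      * by move=> w _; rewrite lee_fin sqr_ge0.
      * by apply/measurable_EFinP; exact: measurable_funX.
      * by apply/measurable_EFinP; exact: measurable_funX.
      * move=> w _; rewrite lee_fin /Z; case: ifPn => [Ya|_].
          by rewrite ifT// (le_trans Ya)// ler_nat.
        by rewrite expr0n/= sqr_ge0.
    + by apply: nearW => n; rewrite ExE// lee_fin.
  - by move=> n; apply/measurable_EFinP; exact: measurable_funX.
  - by move=> n w _; rewrite lee_fin sqr_ge0.
  - move=> w _ a b ab; rewrite lee_fin /Z; case: ifPn => [Ya|_].
      by rewrite ifT// (le_trans Ya)// ler_nat.
    by rewrite expr0n/= sqr_ge0.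
have sY2 : integrableR P (fun w => Y w ^+ 2).
  apply/integrableP; split => //.
  rewrite (eq_integral (fun w => (Y w ^+ 2)%:E)).
    by rewrite (le_lt_trans lim_le)// ltry.
  by move=> w _; rewrite /= ger0_norm// sqr_ge0.
by split => //; rewrite -lee_fin -ExE.
Unshelve. all: by end_near. Qed.

Lemma is_cexp_orthogonal F Y Z : sq_integrable P F -> is_cexp P G F Y ->
  G_measurable Z -> sq_integrable P Z -> Ex P (fun w => Z w * (F w - Y w)) = 0.
Proof.
move=> sF FY mZ sZ; have [sY _] := is_cexp_contraction sF FY.
apply: pull_out => //.
- exact: integrableRB (sq_integrableW sF) (sq_integrableW sY).
- by move=> A; apply: is_cexp_defect => //; exact: sq_integrableW.
- exact: sq_integrableM sZ (sq_integrableB sF sY).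
Qed.

(** [Y1 - Y2] is orthogonal to both [F - Y1] and [F - Y2], hence to itself. *)
Lemma is_cexp_unique F Y1 Y2 : sq_integrable P F -> is_cexp P G F Y1 ->
  is_cexp P G F Y2 -> {ae P, forall w, Y1 w = Y2 w}.
Proof.
move=> sF FY1 FY2; have [sY1 _] := is_cexp_contraction sF FY1.
have [sY2 _] := is_cexp_contraction sF FY2.
have [m1 _ _] := FY1; have [m2 _ _] := FY2.
have sB := sq_integrableB sY1 sY2.
have mB : G_measurable (fun w => Y1 w - Y2 w) by exact: measurable_funB.
suff : {ae P, forall w, Y1 w - Y2 w = 0}.
  by apply: filterS => w /eqP; rewrite subr_eq0 => /eqP.
apply: Ex_sqr0_ae => //.
have := is_cexp_orthogonal sF FY1 mB sB; have := is_cexp_orthogonal sF FY2 mB sB.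
move=> E2 E1; rewrite -(subrr (0 : R)) -{1}E2 -E1 -ExB.
- by congr (Ex P); apply/funext => w; ring.
- exact: sq_integrableM sB (sq_integrableB sF sY2).
- exact: sq_integrableM sB (sq_integrableB sF sY1).
Qed.

End conditional_expectation.

(** * Independence *)

Section dynkin_integral.
Context d (T : measurableType d) (R : realType) (P : probability T R).
Implicit Types (f g : T -> R) (A : set T).

Lemma Rintegral_indic A f : \int[P]_(w in A) f w = Ex P (fun w => \1_A w * f w).
Proof.
rewrite Rintegral_mkcond; congr (Ex P); apply/funext => w.
by rewrite patchE indicE; case: ifPn => _; rewrite ?mul1r ?mul0r.
Qed.

(** A pi-lambda argument: the sets on which the two integrals agree form a Dynkin system. Countable
    unions are handled by the sigma-additivity of the induced charges. *)
Lemma integral_eq_dynkin (C : set (set T)) f g :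
  setI_closed C -> C `<=` measurable -> C [set: T] ->
  integrableR P f -> integrableR P g ->
  (forall A, C A -> \int[P]_(w in A) f w = \int[P]_(w in A) g w) ->
  forall A, <<s C >> A -> \int[P]_(w in A) f w = \int[P]_(w in A) g w.
Proof.
move=> CI Cm CT sf sg fg A; rewrite -(setI_closed_g_dynkin_g_sigma_algebra CI).
pose H : set (set T) := [set A | measurable A /\
  (\int[P]_(w in A) (f w)%:E = \int[P]_(w in A) (g w)%:E)%E].
suff : <<d C >> `<=` H.
  by move=> /[apply] -[_]; rewrite /Rintegral => ->.
have HT : H [set: T] by split => //; apply: integral_setB => //; exact: fg.
apply: smallest_sub; last first.
  by move=> B CB; split; [exact: Cm|apply: integral_setB => //; [exact: Cm|exact: fg]].
split => //.
- move=> B [mB fgB]; have mCB := measurableC mB; split => //.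
  have split_int h : integrableR P h ->
      (\int[P]_w (h w)%:E = \int[P]_(w in B) (h w)%:E + \int[P]_(w in ~` B) (h w)%:E)%E.
    move=> sh; rewrite -(setUv B) integral_setU_EFin//.
    - by apply: measurable_funTS; exact: integrableR_measurable sh.
    - by apply/disj_setPS; rewrite setICr.
  have [_] := HT; rewrite !split_int// fgB.
  have : (\int[P]_(w in B) (g w)%:E)%E \is a fin_num.
    by apply: integrable_fin_num => //; exact: integrableRS.
  have fin_compl h : integrableR P h ->
      (\int[P]_(w in ~` B) (h w)%:E)%E \is a fin_num.
    by move=> sh; apply: integrable_fin_num => //; exact: integrableRS.
  move: (fin_compl _ sf) (fin_compl _ sg).
  case: (integral _ B _) => // r _; case: (integral _ _ _) => // a.
  by case: (integral _ _ _) => // b _ _ [] /addrI ->.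
- move=> F tF HF; have mF n := (HF n).1.
  have mUF : measurable (\bigcup_n F n) by exact: bigcupT_measurable.
  split => //.
  have := @charge_semi_sigma_additive _ _ _ (induced_charge sf) F mF tF mUF.
  have := @charge_semi_sigma_additive _ _ _ (induced_charge sg) F mF tF mUF.
  have -> : (fun n => \sum_(0 <= i < n) induced_charge sf (F i))%E =
            (fun n => \sum_(0 <= i < n) induced_charge sg (F i))%E.
    by apply/funext => n; apply: eq_bigr => i _; exact: (HF i).2.
  by move=> cvg_g cvg_f; have := cvg_unique _ cvg_f cvg_g; exact.
Qed.

End dynkin_integral.

Section independent_sequence.
Context d (T : measurableType d) (R : realType) (P : probability T R).
Context (dE : nat -> measure_display) (E : forall n, measurableType (dE n)).
Variable X : forall n, {RV P >-> E n}.
Implicit Types (J K : set nat) (A : set T).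

Lemma sub_gen J : <<s gen X J >> `<=` (@measurable _ T).
Proof.
apply: smallest_sub; first exact: sigma_algebra_measurable.
by move=> B [j _ [C mC <-]]; exact: measurable_funP.
Qed.

Lemma gen_mono J K : J `<=` K -> <<s gen X J >> `<=` <<s gen X K >>.
Proof.
move=> JK; apply: smallest_sub; first exact: smallest_sigma_algebra.
by move=> B [j /JK Kj XB]; apply: sub_sigma_algebra; exists j.
Qed.

Lemma G_measurable_mono J K (Y : T -> R) : J `<=` K ->
  G_measurable (gen X J) Y -> G_measurable (gen X K) Y.
Proof. by move=> JK mY _ B mB; apply: (gen_mono JK); exact: mY. Qed.

(** A condition is attached to every index, but it is trivial outside [J] and from [N] on. So two
    cylinders intersect coordinate by coordinate, with no bookkeeping of finite index sets. *)
Definition cylinder J A := exists N (B : forall n, set (E n)),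
  [/\ forall n, measurable (B n),
      forall n, (~ J n \/ (N <= n)%N) -> B n = setT
    & A = \bigcap_n (X n @^-1` B n)].

Lemma cylinderT J : cylinder J [set: T].
Proof.
exists 0%N, (fun=> setT); split => //.
by rewrite bigcapT// => n _; rewrite preimage_setT.
Qed.

Lemma cylinderI J : setI_closed (cylinder J).
Proof.
move=> A1 A2 [N1 [B1 [m1 T1 ->]]] [N2 [B2 [m2 T2 ->]]].
exists (maxn N1 N2), (fun n => B1 n `&` B2 n); split.
- by move=> n; exact: measurableI.
- move=> n Jn; rewrite T1 ?T2 ?setTI//.
    by case: Jn; [left|rewrite geq_max => /andP[]; right].
  by case: Jn; [left|rewrite geq_max => /andP[]; right].
- by rewrite -bigcapI.
Qed.

Lemma cylinder_gen J A : cylinder J A -> <<s gen X J >> A.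
Proof.
move=> [N [B [mB TB ->]]].
apply: (@bigcapT_measurable _ (g_sigma_algebraType (gen X J))) => n.
have [Jn|nJn] := pselect (J n).
  apply: sub_sigma_algebra; exists n => //; exists (B n) => //.
  by rewrite setTI.
by rewrite TB; [rewrite preimage_setT; exact: measurableT|left].
Qed.

Lemma gen_cylinder J : <<s gen X J >> `<=` <<s cylinder J >>.
Proof.
apply: smallest_sub; first exact: smallest_sigma_algebra.
move=> _ [j Jj [C mC <-]]; apply: sub_sigma_algebra.
exists j.+1, (eqtype.dfwith (fun n => [set: E n]) C); split.
- by move=> n; case: eqtype.dfwithP.
- move=> n nJ; rewrite eqtype.dfwith_out//; apply/eqP => jn; subst n.
  by case: nJ => //; rewrite ltnn.
- rewrite setTI; apply/seteqP; split => [w Cw n _|w /(_ j I)] /=.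
    by case: eqtype.dfwithP.
  by rewrite eqtype.dfwith_in.
Qed.

Lemma sub_cylinder J : cylinder J `<=` measurable.
Proof. by move=> A /cylinder_gen; exact: sub_gen. Qed.

Hypothesis indepX : mutually_independent X.

Lemma probability_cylinder (N : nat) (B : forall n, set (E n)) :
  (forall n, measurable (B n)) -> (forall n, (N <= n)%N -> B n = setT) ->
  P (\bigcap_n (X n @^-1` B n)) = (\prod_(n < N) P (X n @^-1` B n))%E.
Proof.
move=> mB TB; pose J := [fset n in iota 0 N]%fset.
have -> : \bigcap_n (X n @^-1` B n) = \bigcap_(n in [set` J]) (X n @^-1` B n).
  apply/seteqP; split => w Bw n; first by move=> _; exact: Bw.
  move=> _; have [nN|Nn] := ltnP n N; last by rewrite TB.
  by apply: Bw; rewrite /= !inE mem_iota.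
rewrite indepX; last by move=> n _; exact: mB.
rewrite (perm_big (iota 0 N)); last first.
  apply: uniq_perm; rewrite ?fset_uniq ?iota_uniq// => n.
  by rewrite !inE.
by rewrite -[X in iota 0 X]subn0 big_mkord.
Qed.

(** Since [J] and [K] are disjoint, at each index one of the two conditions is trivial and the
    factor of the product formula splits. *)
Lemma probability_cylinderI J K A1 A2 : J `&` K = set0 ->
  cylinder J A1 -> cylinder K A2 -> P (A1 `&` A2) = (P A1 * P A2)%E.
Proof.
move=> JK [N1 [B1 [m1 T1 ->]]] [N2 [B2 [m2 T2 ->]]].
pose N := maxn N1 N2.
have T1' n : (N <= n)%N -> B1 n = setT.
  by rewrite geq_max => /andP[N1n _]; apply: T1; right.
have T2' n : (N <= n)%N -> B2 n = setT.
  by rewrite geq_max => /andP[_ N2n]; apply: T2; right.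
rewrite -bigcapI (probability_cylinder (N := N) m1 T1').
rewrite (probability_cylinder (N := N) m2 T2').
under eq_bigcapr do rewrite -preimage_setI.
rewrite (probability_cylinder (N := N) (B := fun n => B1 n `&` B2 n)); last 2 first.
- by move=> n; exact: measurableI.
- by move=> n Nn; rewrite T1'// T2'// setTI.
rewrite -big_split/=; apply: eq_bigr => n _.
have [Jn|nJn] := pselect (J n).
  rewrite T2; last by left => Kn; have : (J `&` K) n by []; rewrite JK.
  by rewrite setIT preimage_setT probability_setT mule1.
by rewrite T1; [rewrite setTI preimage_setT probability_setT mul1e|left].
Qed.

(** Independence phrased as a constant conditional expectation, so that [is_cexp_orthogonal] then
    yields the product formula for square integrable [Y]. *)
Lemma is_cexp_indep_cylinder J K A : J `&` K = set0 -> cylinder J A ->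
  is_cexp P (gen X K) \1_A (fun=> fine (P A)).
Proof.
move=> JK JA; have mA := sub_cylinder JA.
have sA : integrableR P (\1_A : T -> R).
  apply: le_integrableR (integrableR_cst P 1); first exact: measurable_indic.
  by move=> w; rewrite indicE normr1; case: (w \in A); rewrite ?normr1 ?normr0.
split; first exact: measurable_cst.
  exact: integrableR_cst.
move=> B /gen_cylinder; move=> CB.
have mB : measurable B.
  move: CB; apply: smallest_sub; first exact: sigma_algebra_measurable.
  exact: sub_cylinder.
apply: integral_setB => //; first exact: integrableR_cst.
move: B CB {mB}; apply: integral_eq_dynkin => //.
- exact: cylinderI.
- exact: sub_cylinder.
- exact: cylinderT.
- exact: integrableR_cst.
- move=> B KB; have mB := sub_cylinder KB.
  rewrite Rintegral_cst//= /Rintegral integral_indic// -fineM ?fin_num_measure//.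
  by congr fine; exact: esym (probability_cylinderI JK JA KB).
Qed.

Lemma sq_integrable_indic A f : measurable A -> sq_integrable P f ->
  sq_integrable P (fun w => \1_A w * f w).
Proof.
move=> mA sf; apply: (le_sq_integrable _ _ sf).
  by apply: measurable_funM sf.1; exact: measurable_indic.
move=> w; rewrite normrM indicE; case: (w \in A); rewrite ?normr1 ?mul1r//.
by rewrite normr0 mul0r.
Qed.

Lemma Ex_indep_cylinder J K A Y : J `&` K = set0 -> cylinder J A ->
  G_measurable (gen X K) Y -> sq_integrable P Y ->
  Ex P (fun w => \1_A w * Y w) = fine (P A) * Ex P Y.
Proof.
move=> JK JA mY sY; have mA := sub_cylinder JA.
have s1 : sq_integrable P (\1_A : T -> R).
  have := sq_integrable_indic mA (sq_integrable_cst P 1).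
  by under eq_fun do rewrite mulr1.
have := is_cexp_orthogonal (sub_gen (J := K)) s1 (is_cexp_indep_cylinder JK JA) mY sY.
under eq_fun do rewrite mulrBr (mulrC (Y _)) (mulrC (Y _)).
rewrite ExB.
- by rewrite ExZ; [move/eqP; rewrite subr_eq0 => /eqP|exact: sq_integrableW].
- exact: sq_integrableM s1 sY.
- exact: integrableRZ (sq_integrableW sY).
Qed.

Lemma cylinder_except k A : cylinder (~` [set k]) A ->
  exists A1 A2, [/\ A = A1 `&` A2, cylinder `I_k A1 &
    cylinder [set n | (k < n)%N] A2].
Proof.
move=> [N [B [mB TB ->]]].
pose B1 n := if (n < k)%N then B n else setT.
pose B2 n := if (k < n)%N then B n else setT.
exists (\bigcap_n (X n @^-1` B1 n)), (\bigcap_n (X n @^-1` B2 n)); split.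
- rewrite -bigcapI; apply: eq_bigcapr => n _; rewrite -preimage_setI /B1 /B2.
  have [nk|kn|->] := ltngtP n k; rewrite ?setIT ?setTI//.
  by rewrite TB//; left; apply.
- exists N, B1; split => // n.
    by rewrite /B1; case: ifP.
  by rewrite /B1; case: ifP => // nk [/(_ nk)//|Nn]; apply: TB; right.
- exists N, B2; split => // n.
    by rewrite /B2; case: ifP.
  by rewrite /B2; case: ifP => // nk [/(_ nk)//|Nn]; apply: TB; right.
Qed.

(** This turns [D_k E[F | F_k]] (one-based) into a martingale increment. A cylinder avoiding the
    index [k] is a past event [A1] and a future event [A2]; [A2] is independent of [X_0, ..., X_k]
    and factors out, and on [A1] both sides integrate to the integral of [F]. *)
Lemma is_cexp_tower k F Y V : sq_integrable P F ->
  is_cexp P (gen_upto X k.+1) F Y -> is_cexp P (gen_upto X k) F V ->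
  is_cexp P (gen_except X k) Y V.
Proof.
move=> sF FY FV.
have [sY _] := is_cexp_contraction (@sub_gen _) sF FY.
have [sV _] := is_cexp_contraction (@sub_gen _) sF FV.
have [mY _ YF] := FY; have [mV _ VF] := FV.
have kk1 : `I_k `<=` `I_k.+1 by move=> n /= nk; exact: ltnW.
have kexc : `I_k `<=` ~` [set k] by move=> n /= nk nEk; move: nk; rewrite nEk ltnn.
have disj : [set n | (k < n)%N] `&` `I_k.+1 = set0.
  by apply/seteqP; split => // n [] /= kn; rewrite ltnS leqNgt kn.
split; first exact: G_measurable_mono mV.
  exact: sq_integrableW.
move=> A GA; have mA := sub_gen GA.
apply: integral_setB => //; try exact: sq_integrableW.
have CA := gen_cylinder GA; move: A CA {GA mA}; apply: integral_eq_dynkin.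
- exact: cylinderI.
- exact: sub_cylinder.
- exact: cylinderT.
- exact: sq_integrableW.
- exact: sq_integrableW.
move=> A /cylinder_except[A1 [A2 [-> c1 c2]]].
have gA1 := cylinder_gen c1.
have key U : G_measurable (gen_upto X k.+1) U -> sq_integrable P U ->
    \int[P]_(w in A1 `&` A2) U w = fine (P A2) * \int[P]_(w in A1) U w.
  move=> mU sU; rewrite !Rintegral_indic.
  rewrite -(Ex_indep_cylinder disj c2)//.
  - by congr (Ex P); apply/funext => w; rewrite setIC indicI/= mulrA.
  - apply: measurable_funM => //; apply: measurable_indic.
    exact: (gen_mono kk1 gA1).
  - by apply: sq_integrable_indic => //; exact: sub_cylinder c1.
rewrite !key//; last exact: G_measurable_mono mV.
by congr (_ * _); rewrite /Rintegral YF ?VF//; exact: (gen_mono kk1 gA1).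
Qed.

Lemma is_cexp_upto0 F : integrableR P F -> is_cexp P (gen_upto X 0) F (fun=> Ex P F).
Proof.
move=> sF; split; [exact: measurable_cst|exact: integrableR_cst|].
move=> A GA; apply: integral_setB; [exact: sub_gen GA|exact: integrableR_cst|by []|].
(* No coordinate has index below 0, so the generated sigma-algebra is trivial. *)
have : A = set0 \/ A = setT.
  move: A GA; apply: smallest_sub; last by move=> A [].
  split; first by left.
  - by move=> A [] ->; [right; rewrite setD0|left; rewrite setDT].
  - move=> A HA; have [[i Ai]|nA] := pselect (exists i, A i = setT).
      by right; apply/seteqP; split => // w _; exists i => //; rewrite Ai.
    left; apply/seteqP; split => // w [i _]; case: (HA i) => [->//|Ai].
    by case: nA; exists i.
by case=> ->; rewrite ?Rintegral_set0// -[LHS]/(Ex P _) Ex_cst.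
Qed.

End independent_sequence.

(** * The domain of the difference operator *)

HB.instance Definition _ (R : realType) :=
  isSFinite.Build _ nat R (@counting nat R)
    (sfinite_measure_sigma_finite (sigma_finite_counting R)).

Section graph_closure.
Context d (T : measurableType d) (R : realType) (P : probability T R).
Context (dE : nat -> measure_display) (E : forall n, measurableType (dE n)).
Variable X : forall n, {RV P >-> E n}.
Notation TX := (g_sigma_algebraType (gen X [set: nat])).

Lemma sqr_Lnorm2 d' (U : measurableType d') (mu : {measure set U -> \bar R})
    (f : U -> R) :
  ('N[mu]_2%:E[(fun w => (f w)%:E)] `^ 2 = \int[mu]_w (f w ^+ 2)%:E)%E.
Proof.
rewrite powR_Lnorm//; apply: eq_integral => w _ /=.
by rewrite powR_mulrn// real_normK// num_real.
Qed.

Lemma Lnorm2_cvg0 d' (U : measurableType d') (mu : {measure set U -> \bar R})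
    (f : nat -> U -> R) :
  ('N[mu]_2%:E[(fun w => (f m w)%:E)] @[m --> \oo] --> 0)%E ->
  forall e : R, 0 < e -> exists N, forall m, (N <= m)%N ->
    (\int[mu]_w (f m w ^+ 2)%:E <= e%:E)%E.
Proof.
move=> /fine_cvgP[fin0 /cvgrPdist_le cvg0] e e0.
have se0 : 0 < Num.sqrt e by rewrite sqrtr_gt0.
have [N _ HN] := filterI fin0 (cvg0 _ se0).
exists N => m Nm; have [fin] := HN m Nm.
rewrite sub0r normrN /= => le_e; rewrite -sqr_Lnorm2 -(fineK fin) poweR_EFin lee_fin.
rewrite powR_mulrn ?fine_ge0 ?Lnorm_ge0// -(sqr_sqrtr (ltW e0)).
by rewrite lerXn2r ?nnegrE ?fine_ge0 ?Lnorm_ge0// (le_trans (ler_norm _)).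
Qed.

Lemma ge0_integral_PX (f : TX -> \bar R) : measurable_fun [set: TX] f ->
  (forall w, 0 <= f w)%E -> (\int[PX X]_w f w = \int[P]_w f w)%E.
Proof.
by move=> mf f0; rewrite /PX ge0_integral_distribution.
Qed.

Lemma L2X_sq_integrable F : L2X X F ->
  G_measurable (gen X [set: nat]) F /\ sq_integrable P F.
Proof.
move=> L2F; have mF : G_measurable (gen X [set: nat]) F.
  by move: L2F; rewrite /L2X inE => /andP[+ _]; rewrite inE.
split => //; have mF' := G_measurableW (@sub_gen _ _ _ _ _ _ X _) mF.
split => //; have /integrableP[mF2] := Lfun2_integrable_sqr L2F.
rewrite ge0_integral_PX//; last exact: measurableT_comp.
by move=> F2; apply/integrableP; split => //; apply/measurable_EFinP; exact: measurable_funX.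
Qed.

Lemma integral_counting_prod d' (U : measurableType d') (Q : probability U R)
    (f : nat * U -> \bar R) : measurable_fun [set: nat * U] f ->
  (forall z, 0 <= f z)%E ->
  (\int[(counting \x Q)%E : {measure set (nat * U) -> \bar R}]_z f z =
   \sum_(k <oo) \int[Q]_w f (k, w))%E.
Proof.
move=> mf f0.
rewrite (@fubini_tonelli1 _ _ _ _ R counting Q f mf f0).
rewrite ge0_integral_count// => k; apply: integral_ge0 => w _; exact: f0.
Qed.

Lemma integral_kappaPX (H : nat * TX -> R) : measurable_fun [set: nat * TX] H ->
  (\int[kappaPX X]_z (H z ^+ 2)%:E =
   \sum_(k <oo) \int[P]_w (H (k, w) ^+ 2)%:E)%E.
Proof.
move=> mH; have mH2 : measurable_fun [set: nat * TX] (fun z => (H z ^+ 2)%:E).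
  by apply/measurable_EFinP; exact: measurable_funX.
have H20 (z : nat * TX) : (0 <= (H z ^+ 2)%:E)%E by rewrite lee_fin sqr_ge0.
rewrite /kappaPX integral_counting_prod//.
apply: eq_eseriesr => k _; apply: ge0_integral_PX.
  exact: measurableT_comp mH2 (measurable_pair1 k).
by move=> w; rewrite lee_fin sqr_ge0.
Qed.

Lemma measurable_nat_prod (H : nat * TX -> R) :
  (forall k, measurable_fun [set: TX] (fun w => H (k, w))) ->
  measurable_fun [set: nat * TX] H.
Proof.
move=> mH _ A mA; rewrite setTI.
rewrite (_ : _ @^-1` _ = \bigcup_k ([set k] `*` ((fun w => H (k, w)) @^-1` A))).
  apply: bigcupT_measurable => k; apply: measurableX => //.
  by rewrite -[X in measurable X]setTI; exact: mH.
apply/seteqP; split => [[k w] HA|[k w] [j _ [/= <-]]//].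
by exists k.
Qed.

Lemma is_cexpB G F1 F2 Y1 Y2 : <<s G >> `<=` (@measurable _ T) ->
  integrableR P F1 -> integrableR P F2 ->
  is_cexp P G F1 Y1 -> is_cexp P G F2 Y2 ->
  is_cexp P G (fun w => F1 w - F2 w) (fun w => Y1 w - Y2 w).
Proof.
move=> sub s1 s2 c1 c2; have [m1 i1 E1] := c1; have [m2 i2 E2] := c2.
split; [exact: measurable_funB|exact: integrableRB|].
move=> A GA; have mA := sub _ GA.
apply: integral_setB => //; try exact: integrableRB.
rewrite !RintegralB//; try exact: integrableRS.
by rewrite /Rintegral E1// E2.
Qed.

Lemma Ex_sqrB_le (f g : T -> R) : sq_integrable P f -> sq_integrable P g ->
  Ex P (fun w => (f w - g w) ^+ 2) <=
  2 * Ex P (fun w => f w ^+ 2) + 2 * Ex P (fun w => g w ^+ 2).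
Proof.
move=> sf sg; rewrite -ExZ; last exact: sf.2.
rewrite -ExZ; last exact: sg.2.
rewrite -ExD; [|exact: integrableRZ sf.2|exact: integrableRZ sg.2].
apply: Ex_le; first exact: (sq_integrableB sf sg).2.
  by apply: integrableRD; apply: integrableRZ; [exact: sf.2|exact: sg.2].
by move=> w; have := sqr_ge0 (f w + g w); rewrite !expr2; lra.
Qed.

Lemma sq_integrable_cexp J F : sq_integrable P F ->
  sq_integrable P (cexp P (gen X J) F).
Proof.
move=> sF; have FY := cexpP (@sub_gen _ _ _ _ _ _ X J) (sq_integrableW sF).
by have [] := is_cexp_contraction (@sub_gen _ _ _ _ _ _ X J) sF FY.
Qed.

Lemma sq_integrable_Dk k F : sq_integrable P F -> sq_integrable P (Dk X k F).
Proof. by move=> sF; exact: sq_integrableB sF (sq_integrable_cexp _ sF). Qed.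

(** The difference of the chosen versions for [F] and [u] is a version for [F - u], to which the
    contraction property applies. The constant is [2 + 2] from [Ex_sqrB_le]. *)
Lemma Dk_lipschitz k F u : sq_integrable P F -> sq_integrable P u ->
  Ex P (fun w => (Dk X k F w - Dk X k u w) ^+ 2) <= 4 * Ex P (fun w => (F w - u w) ^+ 2).
Proof.
move=> sF su; have sub := @sub_gen _ _ _ _ _ _ X (~` [set k]).
have cF := cexpP sub (sq_integrableW sF); have cu := cexpP sub (sq_integrableW su).
have := is_cexpB sub (sq_integrableW sF) (sq_integrableW su) cF cu.
have sB := sq_integrableB sF su.
move=> /(is_cexp_contraction sub sB)[sY EY].
have := Ex_sqrB_le sB sY.
have -> : (fun w => (F w - u w - (cexp P (gen X (~` [set k])) F w -
    cexp P (gen X (~` [set k])) u w)) ^+ 2) =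
    (fun w => (Dk X k F w - Dk X k u w) ^+ 2).
  by apply/funext => w; congr (_ ^+ 2); rewrite /Dk /gen_except /=; ring.
lra.
Qed.

Lemma measurable_D0 F : G_measurable (gen X [set: nat]) F -> integrableR P F ->
  measurable_fun [set: nat * TX] (D0 (X := X) F).
Proof.
move=> mF sF; apply: measurable_nat_prod => k; apply: measurable_funB => //.
have [mY _ _] := cexpP (@sub_gen _ _ _ _ _ _ X (~` [set k])) sF.
exact: G_measurable_mono mY.
Qed.

Lemma D_dom_sq_integrable F : D_dom X F -> sq_integrable P F.
Proof. by move=> [H [/L2X_sq_integrable[]]]. Qed.

(** The form in which the approximating sequence of the closure is used: a single functional of
    finitely many coordinates close to [F], with its differences close to [H]. *)
Lemma D_graph_approx F H : D_graph (X := X) F H -> forall e : R, 0 < e ->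
  exists u n, [/\ G_measurable (gen X [set: nat]) u, sq_integrable P u,
    G_measurable (gen_upto X n) u,
    Ex P (fun w => (F w - u w) ^+ 2) <= e &
    (\int[kappaPX X]_z ((D0 (X := X) u z - H z) ^+ 2)%:E <= e%:E)%E].
Proof.
move=> [L2F _ [u [D0u uF uH]]] e e0; have [mF sF] := L2X_sq_integrable L2F.
have [N1 HN1] := Lnorm2_cvg0 uF e0; have [N2 HN2] := Lnorm2_cvg0 uH e0.
pose m := maxn N1 N2; have [L2u [n mu]] := D0u m.
have [mu' su] := L2X_sq_integrable L2u.
exists (u m), n; split => //; last by apply: HN2; rewrite leq_maxr.
have sB := sq_integrableB su sF.
have -> : (fun w => (F w - u m w) ^+ 2) = (fun w => (u m w - F w) ^+ 2).
  by apply/funext => w; rewrite -opprB sqrrN.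
rewrite -lee_fin -ExE; last exact: sB.2.
have := HN1 m (leq_maxl _ _); rewrite ge0_integral_PX//.
- by apply/measurable_EFinP; apply: measurable_funX; exact: measurable_funB.
- by move=> w; rewrite lee_fin sqr_ge0.
Qed.

Lemma section_le_kappaPX (H : nat * TX -> R) k : measurable_fun [set: nat * TX] H ->
  (\int[P]_w (H (k, w) ^+ 2)%:E <= \int[kappaPX X]_z (H z ^+ 2)%:E)%E.
Proof.
move=> mH; rewrite integral_kappaPX//.
have nn n : (0 <= \int[P]_w (H (n, w) ^+ 2)%:E)%E.
  by apply: integral_ge0 => w _; rewrite lee_fin sqr_ge0.
apply: le_trans (nneseries_lim_ge k.+1 (P := xpredT) _); last by move=> *; exact: nn.
by rewrite big_nat_recr//= leeDr// sume_ge0.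
Qed.

Lemma D_graph_sections F H : D_graph (X := X) F H ->
  (forall k, sq_integrable P (fun w => H (k, w))) /\
  exists C, forall N, \sum_(k < N) Ex P (fun w => H (nat_of_ord k, w) ^+ 2) <= C.
Proof.
move=> [_ L2H _].
have mH : measurable_fun [set: nat * TX] H.
  by move: L2H; rewrite /L2kX inE => /andP[+ _]; rewrite inE.
have /integrableP[_] := Lfun2_integrable_sqr L2H.
rewrite (eq_integral (fun z => (H z ^+ 2)%:E)); last first.
  by move=> z _; rewrite /= ger0_norm ?sqr_ge0.
move=> Hoo.
have sH k : sq_integrable P (fun w => H (k, w)).
  have mHk : measurable_fun [set: T] (fun w => H (k, w)).
    apply: (G_measurableW (@sub_gen _ _ _ _ _ _ X [set: nat])).
    exact: measurableT_comp mH (measurable_pair1 k).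
  split => //; apply/integrableP; split.
    by apply/measurable_EFinP; exact: measurable_funX.
  rewrite (eq_integral (fun w : T => (H (k, w) ^+ 2)%:E)); last first.
    by move=> w _; rewrite /= ger0_norm ?sqr_ge0.
  exact: le_lt_trans (section_le_kappaPX k mH) Hoo.
split => //; exists (fine (\int[kappaPX X]_z (H z ^+ 2)%:E)%E) => N.
rewrite -lee_fin fineK; last first.
  by rewrite ge0_fin_numE// integral_ge0// => z _; rewrite lee_fin sqr_ge0.
rewrite integral_kappaPX// -sumEFin.
under eq_bigr do rewrite -ExE ?(sH _).2//.
apply: le_trans (nneseries_lim_ge N (P := xpredT) _); first by rewrite big_mkord.
by move=> n _ _; apply: integral_ge0 => w _; rewrite lee_fin sqr_ge0.
Qed.

(** The [D_k] of the statement is defined by conditioning, whereas the closure provides [H]. Through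
    an approximating [u], [D_k F] is compared with [H (k, _)]; the factor 2 is harmless, as only
    summability over [k] is wanted. *)
Lemma Dk_energy_le F H k : D_graph (X := X) F H ->
  Ex P (fun w => Dk X k F w ^+ 2) <= 2 * Ex P (fun w => H (k, w) ^+ 2).
Proof.
move=> DFH; have [sH _] := D_graph_sections DFH.
have [L2F L2H _] := DFH; have [mF sF] := L2X_sq_integrable L2F.
have mH : measurable_fun [set: nat * TX] H.
  by move: L2H; rewrite /L2kX inE => /andP[+ _]; rewrite inE.
apply/ler_addgt0Pr => e e0.
(* The errors add up to [2 (2 * 4 + 2) = 20] times this quantity. *)
have e20 : 0 < e / 20 by rewrite divr_gt0.
have [u [n [mu su _ EFu EuH]]] := D_graph_approx DFH e20.
have sDF := sq_integrable_Dk k sF; have sDu := sq_integrable_Dk k su.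
have mB : measurable_fun [set: nat * TX] (fun z => D0 (X := X) u z - H z).
  by apply: measurable_funB => //; exact: measurable_D0 (sq_integrableW su).
have E1 : Ex P (fun w => (Dk X k u w - H (k, w)) ^+ 2) <= e / 20.
  rewrite -lee_fin -ExE; last exact: (sq_integrableB sDu (sH k)).2.
  exact: le_trans (section_le_kappaPX k mB) EuH.
have E2 := Dk_lipschitz k sF su.
(* [Ex_sqrB_le] speaks of differences; the factor [- 1] makes it a bound for sums. *)
have sHN := sq_integrableZ (- 1) (sH k).
have E3 := Ex_sqrB_le (sq_integrableB sDF (sH k)) sHN.
have E4 := Ex_sqrB_le (sq_integrableB sDF sDu)
  (sq_integrableZ (- 1) (sq_integrableB sDu (sH k))).
move: E3 E4.
have -> : (fun w : T => (Dk X k F w - H (k, w) - -1 * H (k, w)) ^+ 2) =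
    (fun w : T => Dk X k F w ^+ 2) by apply/funext => w; congr (_ ^+ 2); ring.
have -> : (fun w : T => (Dk X k F w - Dk X k u w - -1 * (Dk X k u w - H (k, w))) ^+ 2) =
    (fun w : T => (Dk X k F w - H (k, w)) ^+ 2).
  by apply/funext => w; congr (_ ^+ 2); ring.
have -> : (fun w : T => (-1 * H (k, w)) ^+ 2) = (fun w : T => H (k, w) ^+ 2).
  by apply/funext => w; rewrite mulN1r sqrrN.
have -> : (fun w : T => (-1 * (Dk X k u w - H (k, w))) ^+ 2) =
    (fun w : T => (Dk X k u w - H (k, w)) ^+ 2).
  by apply/funext => w; rewrite mulN1r sqrrN.
have aux (x a b c h f : R) : x <= 2 * a + 2 * h -> a <= 2 * b + 2 * c ->
    b <= 4 * f -> c <= e / 20 -> f <= e / 20 -> x <= 2 * h + e by lra.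
by move=> E3 E4; exact: aux E3 E4 E2 E1 EFu.
Qed.

Lemma D_dom_energy F : D_dom X F ->
  exists C, forall N, \sum_(k < N) Ex P (fun w => Dk X k F w ^+ 2) <= C.
Proof.
move=> [H DFH]; have [_ [C HC]] := D_graph_sections DFH.
exists (2 * C) => N.
apply: (@le_trans _ _ (2 * \sum_(k < N) Ex P (fun w => H (nat_of_ord k, w) ^+ 2))).
  by rewrite mulr_sumr; apply: ler_sum => k _; exact: Dk_energy_le.
by rewrite ler_pM2l.
Qed.

(* [E[F | F_n]] is the best approximation of [F], and [F] is an L2-limit of
   functionals of finitely many coordinates. *)
Lemma D_dom_upto_cvg F : D_dom X F -> forall e : R, 0 < e -> exists N, forall n,
  (N <= n)%N -> Ex P (fun w => (F w - cexp P (gen_upto X n) F w) ^+ 2) <= e.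
Proof.
move=> DF e e0; have sF := D_dom_sq_integrable DF.
have [H /D_graph_approx/(_ e e0)[u [N [_ su mu EFu _]]]] := DF.
exists N => n Nn; apply: le_trans EFu.
have sub := @sub_gen _ _ _ _ _ _ X `I_n.
have cY := cexpP sub (sq_integrableW sF); set Y := cexp _ _ _.
have sY : sq_integrable P Y by exact: sq_integrable_cexp.
have mZ : G_measurable (gen X `I_n) (fun w => Y w - u w).
  have [mY _ _] := cY; apply: measurable_funB => //.
  by apply: G_measurable_mono mu => i /= iN; exact: leq_trans Nn.
have sZ := sq_integrableB sY su; have sFY := sq_integrableB sF sY.
have orth := is_cexp_orthogonal sub sF cY mZ sZ.
have -> : Ex P (fun w => (F w - u w) ^+ 2) =
    Ex P (fun w => (F w - Y w) ^+ 2 + ((Y w - u w) ^+ 2 + 2 * ((Y w - u w) * (F w - Y w)))).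
  by congr (Ex P); apply/funext => w; ring.
have i1 := integrableRZ 2 (sq_integrableM sZ sFY).
rewrite ExD; [|exact: sFY.2|exact: integrableRD sZ.2 i1].
rewrite ExD//; last exact: sZ.2.
rewrite ExZ; last exact: sq_integrableM sZ sFY.
rewrite orth mulr0 addr0 lerDl.
by apply: Ex_ge0 => w; exact: sqr_ge0.
Qed.

End graph_closure.

(** * The normal approximation bounds *)

Section summable_series.
Context d (T : measurableType d) (R : realType) (P : probability T R).
Variable f : nat -> T -> R.
Hypothesis mf : forall k, measurable_fun [set: T] (f k).

Let S w : R := limn (fun n => \sum_(0 <= k < n) f k w).
Let Sn n w : R := \sum_(0 <= k < n) f k w.

(** The Cauchy criterion with countable quantifiers only, so that the set of convergence is visibly
    measurable. *)
Lemma cauchy_near_inv (u : nat -> R) :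
  cvgn (series u) <-> forall i, exists N, forall m n, (N <= m)%N -> (N <= n)%N ->
    `|\sum_(m <= k < n) u k| < i.+1%:R^-1.
Proof.
split.
  move=> /cauchy_cvgP/cauchy_seriesP uc i.
  have i0 : 0 < i.+1%:R^-1 :> R by [].
  have [[A B] /= [[N1 _ AN1] [N2 _ BN2]] AB] := uc _ i0.
  exists (maxn N1 N2) => m n; rewrite !geq_max => /andP[m1 _] /andP[_ n2].
  by apply: (AB (m, n)); split => /=; [exact: AN1|exact: BN2].
move=> uc; apply/cauchy_cvgP/cauchy_seriesP => e e0.
have [N HN] := uc (Num.truncn e^-1).
exists ([set n | (N <= n)%N], [set n | (N <= n)%N]).
  by split; exists N.
move=> [m n] /= [mN nN]; apply: lt_le_trans (HN m n mN nN) _.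
by rewrite invf_ple ?posrE// ltW// truncnS_gt.
Qed.

Lemma measurable_cvg_series : measurable [set w | cvgn (Sn ^~ w)].
Proof.
rewrite (_ : [set w | _] = \bigcap_i \bigcup_N \bigcap_m \bigcap_n
  [set w | (N <= m)%N -> (N <= n)%N -> `|\sum_(m <= k < n) f k w| < i.+1%:R^-1]).
  apply: bigcapT_measurable => i; apply: bigcupT_measurable => N.
  apply: bigcapT_measurable => m; apply: bigcapT_measurable => n.
  have [Nm|Nm] := boolP (N <= m)%N; last first.
    by rewrite (_ : [set w | _] = setT)//; apply/seteqP; split.
  have [Nn|Nn] := boolP (N <= n)%N; last first.
    by rewrite (_ : [set w | _] = setT)//; apply/seteqP; split.
  have mfun : measurable_fun [set: T] (fun w => `|\sum_(m <= k < n) f k w| < i.+1%:R^-1).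
    apply: measurable_fun_ltr => //; apply: measurableT_comp => //.
    exact: measurable_sum.
  rewrite (_ : [set w | _] = (fun w => `|\sum_(m <= k < n) f k w| < i.+1%:R^-1) @^-1` [set true]).
    by rewrite -[X in measurable X]setTI; exact: mfun.
  by apply/seteqP; split => w /= H //; apply: H.
apply/seteqP; split => w /=.
  move=> /(cauchy_near_inv (f ^~ w)).1 H i _; have [N HN] := H i.
  by exists N => // m _ n _; exact: HN.
move=> H; apply/(cauchy_near_inv (f ^~ w)).2 => i.
by have [N _ HN] := H i I; exists N => m n; exact: HN.
Qed.

Lemma measurable_limn_series : measurable_fun [set: T] S.
Proof.
have mC := measurable_cvg_series; set C := [set w | _] in mC.
rewrite -(setUv C); apply/measurable_funU => //; first exact: measurableC.
split.
  apply: (measurable_fun_cvg (h := Sn)) => [n|w Cw].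
    by apply: measurable_funTS; exact: measurable_sum.
  exact: Cw.
(* Where the series diverges, [limn] returns its default value, a constant. *)
apply: (eq_measurable_fun (fun=> point : R)); last exact: measurable_cst.
by move=> w; rewrite inE => nCw; rewrite /S dvgP.
Qed.

Variable C : R.
Hypothesis sf : forall k, integrableR P (f k).
Hypothesis fC : forall N, \sum_(k < N) Ex P (fun w => `|f k w|) <= C.

Let G w : \bar R := (\sum_(k <oo) (`|f k w|%:E))%E.

Let integrable_G : P.-integrable [set: T] G.
Proof.
have mnf k : measurable_fun [set: T] (fun w => `|f k w|%:E).
  by apply/measurable_EFinP; exact: measurableT_comp.
have mG : measurable_fun [set: T] G by apply: ge0_emeasurable_sum => // *.
have G0 w : (0 <= G w)%E by apply: nneseries_ge0 => *; rewrite lee_fin.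
apply/integrableP; split => //; under eq_integral do rewrite gee0_abs//.
rewrite integral_nneseries//.
apply: (@le_lt_trans _ _ C%:E); last by rewrite ltry.
apply: lime_le.
  by apply: is_cvg_nneseries => k _ _; apply: integral_ge0 => w _; rewrite lee_fin.
apply: nearW => N; rewrite big_mkord; under eq_bigr do rewrite ExE ?integrableR_norm//.
by rewrite sumEFin lee_fin.
Qed.

Let Sn_le_G n w : (`|Sn n w|%:E <= G w)%E.
Proof.
apply: (@le_trans _ _ (\sum_(0 <= k < n) `|f k w|)%:E).
  by rewrite lee_fin; exact: ler_norm_sum.
by rewrite -sumEFin; apply: nneseries_lim_ge => *; rewrite lee_fin.
Qed.

Let cvg_Sn : {ae P, forall w, Sn n w @[n --> \oo] --> S w}.
Proof.
have := integrable_ae measurableT integrable_G; apply: filterS => w /(_ I) Gfin.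
suff : cvgn (series (f ^~ w)) by [].
apply: normed_cvg; apply: nondecreasing_is_cvgn.
  have nd : nondecreasing_seq (fun n => \sum_(0 <= k < n) `|f k w|).
    by apply/nondecreasing_seqP => n; rewrite big_nat_recr//= lerDl.
  exact: nd.
exists (fine (G w)) => _ [n _ <-]; rewrite -lee_fin fineK// /series/= -sumEFin.
by apply: nneseries_lim_ge => *; rewrite lee_fin.
Qed.

(** Dominated convergence under [|c| + G], with [G] the sum of absolute values. It serves the Stein
    defect with [c = 1] and the last Kolmogorov term with [c = 0]. *)
Lemma Ex_norm_series_cvg (c : R) : integrableR P (fun w => `|c - S w|) /\
  Ex P (fun w => `|c - Sn n w|) @[n --> \oo] --> Ex P (fun w => `|c - S w|).
Proof.
have mS := measurable_limn_series.
have mSn n : measurable_fun [set: T] (Sn n) by exact: measurable_sum.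
have sSn n : integrableR P (fun w => `|c - Sn n w|).
  apply: integrableR_norm; apply: integrableRB; first exact: integrableR_cst.
  exact: integrableR_sum.
have [] := @dominated_convergence _ _ _ P _ measurableT
  (fun n w => `|c - Sn n w|%:E) (fun w => `|c - S w|%:E)
  (fun w => `|c|%:E + G w)%E _ _ _ _ _.
- by move=> n; apply/measurable_EFinP; apply: measurableT_comp => //; exact: measurable_funB.
- by apply/measurable_EFinP; apply: measurableT_comp => //; exact: measurable_funB.
- apply: filterS cvg_Sn => w Sw _; apply: cvg_EFin; first exact: nearW.
  by apply: cvg_norm; apply: cvgB Sw; exact: cvg_cst.
- exact: integrableD (integrableR_cst P `|c|) integrable_G.
- apply: aeW => w n _ /=; rewrite normr_id (le_trans _ (leeD2l _ (Sn_le_G n w)))//.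
  by rewrite -EFinD lee_fin ler_normB.
move=> iS _ cvS; split => //.
by rewrite /Ex /Rintegral; apply: fine_cvg; rewrite ExE// in cvS *.
Qed.

End summable_series.

(** * Martingale increments and the abstract Stein bound *)

Section malliavin_stein.
Context d (T : measurableType d) (R : realType) (P : probability T R).
Context (dE : nat -> measure_display) (E : forall n, measurableType (dE n)).
Variable X : forall n, {RV P >-> E n}.
Hypothesis indepX : mutually_independent X.
Variable F : T -> R.
Hypothesis DF : D_dom X F.
Hypothesis EF0 : Ex P F = 0.

Definition upto n : T -> R := cexp P (gen_upto X n) F.
Definition increment k : T -> R := Dk X k (upto k.+1).
Notation a := increment.
Notation b k := (Dk X k F).
Notation cond k := (cexp P (gen_except X k)).

Let sF : sq_integrable P F. Proof. exact: D_dom_sq_integrable DF. Qed.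

Lemma is_cexp_upto n : is_cexp P (gen_upto X n) F (upto n).
Proof. exact: (cexpP (@sub_gen _ _ _ _ _ _ X _) (sq_integrableW sF)). Qed.

Lemma sq_integrable_upto n : sq_integrable P (upto n).
Proof. exact: sq_integrable_cexp. Qed.

Lemma sq_integrable_increment k : sq_integrable P (a k).
Proof. exact: sq_integrable_Dk (sq_integrable_upto _). Qed.

Let sb k : sq_integrable P (b k). Proof. exact: sq_integrable_Dk. Qed.

Lemma is_cexp_cond k f : sq_integrable P f -> is_cexp P (gen_except X k) f (cond k f).
Proof. by move=> sf; exact: (cexpP (@sub_gen _ _ _ _ _ _ X _) (sq_integrableW sf)). Qed.

Lemma Dk_orthogonal k f Y : sq_integrable P f -> G_measurable (gen_except X k) Y ->
  sq_integrable P Y -> Ex P (fun w => Y w * Dk X k f w) = 0.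
Proof.
move=> sf mY sY.
exact: (is_cexp_orthogonal (@sub_gen _ _ _ _ _ _ X _) sf (is_cexp_cond k sf) mY sY).
Qed.

(** By the tower property [upto k] is another version of the conditional expectation subtracted in
    [increment]; versions agree only almost surely. *)
Lemma increment_ae k : {ae P, forall w, a k w = upto k.+1 w - upto k w}.
Proof.
have tower := is_cexp_tower indepX sF (is_cexp_upto k.+1) (is_cexp_upto k).
have := is_cexp_unique (@sub_gen _ _ _ _ _ _ X _) (sq_integrable_upto k.+1)
  (is_cexp_cond k (sq_integrable_upto k.+1)) tower.
by apply: filterS => w; rewrite /increment /Dk /= => ->.
Qed.

Lemma sum_increment_ae n : {ae P, forall w, \sum_(k < n) a k w = upto n w}.
Proof.
elim: n => [|n IH].
  have := is_cexp_unique (@sub_gen _ _ _ _ _ _ X _) sF (is_cexp_upto 0)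
    (is_cexp_upto0 X (sq_integrableW sF)).
  by apply: filterS => w ->; rewrite big_ord0 EF0.
apply: filterS2 IH (increment_ae n) => w IH aE.
by rewrite big_ord_recr/= IH aE; ring.
Qed.

Lemma Ex_sqr_increment k : Ex P (fun w => a k w ^+ 2) =
  Ex P (fun w => upto k.+1 w ^+ 2) - Ex P (fun w => upto k w ^+ 2).
Proof.
have s1 := sq_integrable_upto k.+1; have s0 := sq_integrable_upto k.
have sB := sq_integrableB s1 s0.
transitivity (Ex P (fun w => (upto k.+1 w - upto k w) ^+ 2)).
  apply: Ex_ae_eq; [exact: (sq_integrable_increment k).2|exact: sB.2|].
  by apply: filterS (increment_ae k) => w ->.
have [m0 _ _] := is_cexp_upto k.
have m1 : G_measurable (gen X `I_k.+1) (upto k).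
  by apply: G_measurable_mono m0 => n /= nk; exact: ltnW.
have o1 := is_cexp_orthogonal (@sub_gen _ _ _ _ _ _ X _) sF (is_cexp_upto k.+1) m1 s0.
have o0 := is_cexp_orthogonal (@sub_gen _ _ _ _ _ _ X _) sF (is_cexp_upto k) m0 s0.
have i1 := sq_integrableM s0 (sq_integrableB sF s1).
have i0 := sq_integrableM s0 (sq_integrableB sF s0).
(* Pythagoras: the cross term is rewritten through [F], since [upto k] is orthogonal to both
   [F - upto k.+1] and [F - upto k]. *)
have -> : (fun w => (upto k.+1 w - upto k w) ^+ 2) = (fun w =>
    (upto k.+1 w ^+ 2 - upto k w ^+ 2) +
    2 * (upto k w * (F w - upto k.+1 w) - upto k w * (F w - upto k w))).
  by apply/funext => w; ring.
have i01 := integrableRB i1 i0.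
rewrite ExD; [|exact: integrableRB s1.2 s0.2|exact: integrableRZ].
rewrite (ExB s1.2 s0.2) ExZ// (ExB i1 i0) o1 o0.
by rewrite subrr mulr0 addr0.
Qed.

Lemma increment_energy n : \sum_(k < n) Ex P (fun w => a k w ^+ 2) <= Ex P (fun w => F w ^+ 2).
Proof.
have [_ up_le] := is_cexp_contraction (@sub_gen _ _ _ _ _ _ X _) sF (is_cexp_upto n).
apply: le_trans up_le.
have -> : \sum_(k < n) Ex P (fun w => a k w ^+ 2) =
    Ex P (fun w => upto n w ^+ 2) - Ex P (fun w => upto 0 w ^+ 2).
  elim: n => [|n IH]; first by rewrite big_ord0 subrr.
  by rewrite big_ord_recr/= IH Ex_sqr_increment; ring.
by rewrite gerBl Ex_ge0// => w; exact: sqr_ge0.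
Qed.

(** Stated for a general [c] because it is needed for [a_k] and for the conditional expectations of
    [|a_k|], whose energies are no larger. *)
Lemma sum_Ex_normM_le (c : nat -> T -> R) :
  (forall k, sq_integrable P (c k)) ->
  (forall k, Ex P (fun w => c k w ^+ 2) <= Ex P (fun w => a k w ^+ 2)) ->
  exists C, forall n, \sum_(k < n) Ex P (fun w => `|c k w * b k w|) <= C.
Proof.
move=> sc ca; have [C HC] := D_dom_energy DF.
exists (Ex P (fun w => F w ^+ 2) + C) => n.
apply: le_trans (lerD (increment_energy n) (HC n)).
rewrite -big_split/=; apply: ler_sum => k _.
apply: le_trans (Ex_normM_le ltr01 (sc k) (sb k)) _.
by rewrite invr1 !mul1r lerD2r.
Qed.

(** [f1] is any function in the role of a derivative: the Kolmogorov solution is not differentiable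
    at its threshold. *)
Definition taylor_rem (f f1 : R -> R) x y : R := f x - f y - f1 x * (x - y).

Section test_function.
Variables (f f1 : R -> R) (L K : R).
Hypothesis mf1 : measurable_fun [set: R] f1.
Hypothesis f_lip : forall x y, `|f x - f y| <= L * `|x - y|.
Hypothesis f1_le : forall x, `|f1 x| <= K.

Lemma continuous_of_lip : continuous f.
Proof.
move=> x; apply/cvgrPdist_le => e e0; near=> y.
apply: (@le_trans _ _ ((`|L| + 1) * `|x - y|)).
  by rewrite (le_trans (f_lip x y))// ler_wpM2r// (le_trans (ler_norm _))// lerDl.
rewrite -ler_pdivlMl//; near: y; apply: cvgr_dist_le => //.
by rewrite mulr_gt0 ?invr_gt0.
Unshelve. all: by end_near. Qed.

Let mf : measurable_fun [set: R] f.
Proof. exact: continuous_measurable_fun continuous_of_lip. Qed.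

Lemma sq_integrable_lip_comp Y : sq_integrable P Y -> sq_integrable P (f \o Y).
Proof.
move=> sY; have mY := sY.1.
apply: (@le_sq_integrable _ _ _ _ _ (fun w => `|L| * `|Y w| + `|f 0|)).
- exact: measurableT_comp.
- move=> w; rewrite [leRHS]ger0_norm ?addr_ge0 ?mulr_ge0//=.
  rewrite -[X in `|X| <= _](subrK (f 0)) (le_trans (ler_normD _ _))// lerD2r.
  by rewrite (le_trans (f_lip _ _))// subr0 ler_wpM2r// ler_norm.
- apply: sq_integrableD (sq_integrable_cst _ _); apply: sq_integrableZ.
  exact: sq_integrable_norm.
Qed.

Notation rem := (taylor_rem f f1).

Lemma cond_comp_measurable k : G_measurable (gen_except X k) (f \o cond k F).
Proof.
have [mY _ _] := is_cexp_cond k sF.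
exact: (measurableT_comp mf mY).
Qed.

Let sf1b k : sq_integrable P (fun w => b k w * f1 (F w)).
Proof.
exact: (@sq_integrable_bounded _ _ _ P K (b k) (f1 \o F)
  (measurableT_comp mf1 sF.1) (fun w => f1_le (F w)) (sb k)).
Qed.

Let sf1ab k : integrableR P (fun w => f1 (F w) * (a k w * b k w)).
Proof.
have := sq_integrableM (sq_integrable_increment k) (sf1b k).
by congr (integrableR P _); apply/funext => w /=; ring.
Qed.

Let sfF : sq_integrable P (f \o F). Proof. exact: sq_integrable_lip_comp. Qed.

Let sfcF k : sq_integrable P (f \o cond k F).
Proof. by apply: sq_integrable_lip_comp; exact: sq_integrable_cexp. Qed.

Let increment_comp k w : f (F w) * a k w = f (cond k F w) * a k w +
  (f1 (F w) * (a k w * b k w) + a k w * rem (F w) (F w - b k w)).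
Proof.
have bE : b k w = F w - cond k F w by [].
by rewrite /taylor_rem bE subKr; ring.
Qed.

Lemma integrable_increment_rem k :
  integrableR P (fun w => a k w * rem (F w) (F w - b k w)).
Proof.
have sa := sq_integrable_increment k.
have -> : (fun w => a k w * rem (F w) (F w - b k w)) = (fun w =>
  (f (F w) * a k w - f (cond k F w) * a k w) - f1 (F w) * (a k w * b k w)).
  by apply/funext => w; rewrite increment_comp; ring.
apply: integrableRB => //.
exact: integrableRB (sq_integrableM sfF sa) (sq_integrableM (sfcF k) sa).
Qed.

(* [F - D_k F = E[F | G_k]] and [a_k] is orthogonal to G_k-measurable functions. *)
Lemma Ex_increment_comp k : Ex P (fun w => f (F w) * a k w) =
  Ex P (fun w => f1 (F w) * (a k w * b k w)) +
  Ex P (fun w => a k w * rem (F w) (F w - b k w)).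
Proof.
have o := Dk_orthogonal (sq_integrable_upto k.+1) (@cond_comp_measurable k) (sfcF k).
have i2 := integrable_increment_rem k.
have -> : (fun w => f (F w) * a k w) = (fun w => f (cond k F w) * a k w +
    (f1 (F w) * (a k w * b k w) + a k w * rem (F w) (F w - b k w))).
  by apply/funext => w; exact: increment_comp.
rewrite ExD; [|exact: sq_integrableM (sfcF k) (sq_integrable_increment k)|exact: integrableRD].
by rewrite o add0r ExD.
Qed.

Let sf1F : sq_integrable P (f1 \o F).
Proof.
apply: le_sq_integrable (sq_integrable_cst P K).
  exact: measurableT_comp mf1 sF.1.
by move=> w; rewrite (le_trans (f1_le _))// ler_norm.
Qed.

Let sab k : integrableR P (fun w => a k w * b k w).
Proof. exact: sq_integrableM (sq_integrable_increment k) (sb k). Qed.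

Let S n w := \sum_(0 <= k < n) a k w * b k w.

(** The exact identity at finite [n]; only the replacement of [upto n] by the sum of increments is
    an almost sure statement. *)
Lemma Ex_upto_comp n : Ex P (fun w => f1 (F w)) - Ex P (fun w => upto n w * f (F w)) =
  Ex P (fun w => f1 (F w) * (1 - S n w)) -
  \sum_(k < n) Ex P (fun w => a k w * rem (F w) (F w - b k w)).
Proof.
have sS : integrableR P (fun w => f1 (F w) * S n w).
  have -> : (fun w => f1 (F w) * S n w) =
      (fun w => \sum_(0 <= k < n) f1 (F w) * (a k w * b k w)).
    by apply/funext => w; rewrite /S mulr_sumr.
  exact: integrableR_sum.
have -> : Ex P (fun w => f1 (F w) * (1 - S n w)) =
    Ex P (fun w => f1 (F w)) - Ex P (fun w => f1 (F w) * S n w).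
  rewrite -(ExB (sq_integrableW sf1F) sS).
  by congr (Ex P); apply/funext => w /=; ring.
suff -> : Ex P (fun w => upto n w * f (F w)) = Ex P (fun w => f1 (F w) * S n w) +
    \sum_(k < n) Ex P (fun w => a k w * rem (F w) (F w - b k w)) by rewrite opprD addrA.
transitivity (Ex P (fun w => \sum_(0 <= k < n) f (F w) * a k w)).
  apply: Ex_ae_eq.
  - exact: sq_integrableM (sq_integrable_upto n) sfF.
  - by apply: integrableR_sum => k; exact: sq_integrableM sfF (sq_integrable_increment k).
  - apply: filterS (sum_increment_ae n) => w <-.
    by rewrite big_mkord mulr_suml; apply: eq_bigr => k _; rewrite mulrC.
rewrite Ex_sum; last by move=> k; exact: sq_integrableM sfF (sq_integrable_increment k).
have -> : Ex P (fun w => f1 (F w) * S n w) =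
    \sum_(0 <= k < n) Ex P (fun w => f1 (F w) * (a k w * b k w)).
  rewrite -Ex_sum//; congr (Ex P); apply/funext => w.
  by rewrite /S mulr_sumr.
rewrite !big_mkord -big_split/=; apply: eq_bigr => k _.
exact: Ex_increment_comp.
Qed.

Lemma Ex_upto_comp_cvg e : 0 < e -> exists N, forall n, (N <= n)%N ->
  `|Ex P (fun w => F w * f (F w)) - Ex P (fun w => upto n w * f (F w))| <= e.
Proof.
move=> e0; pose V := Ex P (fun w => f (F w) ^+ 2).
have V0 : 0 <= V by apply: Ex_ge0 => w; exact: sqr_ge0.
(* The weight [c] makes the second Cauchy-Schwarz term [V / c] at most [e / 2]; then [n] is taken
   large for the first. Adding 1 keeps [c] positive when [V] is zero. *)
have V1 : 0 < V + 1 by rewrite ltr_wpDl.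
pose c := 2 * (V + 1) / e; have c0 : 0 < c by rewrite divr_gt0 ?mulr_gt0.
have ec0 : 0 < e / 2 / c by apply: divr_gt0 => //; exact: divr_gt0.
have [N HN] := D_dom_upto_cvg DF ec0.
exists N => n Nn.
have sFu := sq_integrableB sF (sq_integrable_upto n).
rewrite -ExB; [|exact: sq_integrableM sF sfF|exact: sq_integrableM (sq_integrable_upto n) sfF].
have -> : (fun w => F w * f (F w) - upto n w * f (F w)) =
    (fun w => (F w - upto n w) * f (F w)) by apply/funext => w; rewrite mulrBl.
apply: le_trans (Ex_norm (sq_integrableM sFu sfF)) _.
apply: le_trans (Ex_normM_le c0 sFu sfF) _.
have h1 : c * Ex P (fun w => (F w - upto n w) ^+ 2) <= e / 2.
  by rewrite -ler_pdivlMl// mulrC; exact: HN.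
have h2 : c^-1 * V <= e / 2.
  have -> : c^-1 = e / (2 * (V + 1)) by rewrite invf_div.
  by rewrite mulrAC ler_pdivrMr ?mulr_gt0//; nra.
rewrite [leRHS](_ : _ = e / 2 + e / 2); last by field.
exact: lerD h1 h2.
Qed.

(** The remainder bound has a fixed part [M], coming from a series of nonnegative terms, and a part
    [rn] that varies with [n], since the last Kolmogorov term has its absolute value outside the
    series and is reached only in the limit. *)
Lemma stein_bound (M r : R) (rn : nat -> R) :
  (forall n, `|\sum_(k < n) Ex P (fun w => a k w * rem (F w) (F w - b k w))| <= M + rn n) ->
  rn n @[n --> \oo] --> r ->
  `|Ex P (fun w => f1 (F w)) - Ex P (fun w => F w * f (F w))| <=
  K * Ex P (fun w => `|1 - limn (fun n => \sum_(0 <= k < n) a k w * b k w)|) + (M + r).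
Proof.
move=> Hrem cvr.
have [C HC] := sum_Ex_normM_le sq_integrable_increment (fun k => lexx _).
have mab k := integrableR_measurable (sab k).
have [_ cvS] := Ex_norm_series_cvg mab sab HC 1.
set SS := Ex P _ in cvS *.
have K0 : 0 <= K by exact: le_trans (normr_ge0 _) (f1_le 0).
have bound n : `|Ex P (fun w => f1 (F w)) - Ex P (fun w => upto n w * f (F w))| <=
    K * Ex P (fun w => `|1 - S n w|) + (M + rn n).
  rewrite Ex_upto_comp; apply: le_trans (ler_normB _ _) _; apply: lerD (Hrem n).
  have sS1 : integrableR P (fun w => 1 - S n w).
    by apply: integrableRB (integrableR_cst P 1) _; exact: integrableR_sum.
  have m1 : measurable_fun [set: T] (fun w => f1 (F w) * (1 - S n w)).
    apply: measurable_funM (integrableR_measurable sS1).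
    exact: measurableT_comp mf1 sF.1.
  have i1 : integrableR P (fun w => f1 (F w) * (1 - S n w)).
    apply: le_integrableR (integrableRZ K sS1) => // w.
    by rewrite normrM (normrM K) ler_wpM2r// (le_trans (f1_le _))// ler_norm.
  apply: le_trans (Ex_norm i1) _; rewrite -ExZ; last exact: integrableR_norm.
  apply: Ex_le; [exact: integrableR_norm|exact: integrableRZ (integrableR_norm sS1)|].
  by move=> w; rewrite normrM ler_wpM2r// f1_le.
apply/ler_addgt0Pr => e e0; have e3 : 0 < e / 3 by rewrite divr_gt0.
have [N1 HN1] := Ex_upto_comp_cvg e3.
(* [K] may be zero, hence [K + 1] in the denominator. *)
have eK : 0 < e / 3 / (K + 1) by rewrite divr_gt0// ltr_wpDl.
have [N2 _ HN2] := (cvgrPdist_le _ _).1 cvS _ eK.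
have [N3 _ HN3] := (cvgrPdist_le _ _).1 cvr _ e3.
pose n := maxn N1 (maxn N2 N3).
have n1 : (N1 <= n)%N by rewrite leq_maxl.
have n2 : (N2 <= n)%N by rewrite /n maxnCA leq_maxl.
have n3 : (N3 <= n)%N by rewrite /n maxnA leq_maxr.
have h1 := HN1 n n1; have h2 := HN2 n n2; have h3 := HN3 n n3.
have h2' : K * `|SS - Ex P (fun w => `|1 - S n w|)| <= e / 3.
  apply: (@le_trans _ _ ((K + 1) * (e / 3 / (K + 1)))).
    by apply: ler_pM => //; rewrite lerDl.
  by rewrite mulrCA divff ?mulr1// gt_eqF// ltr_wpDl.
have aux (A B U s SS' rn' : R) : `|B - U| <= e / 3 -> K * `|SS' - s| <= e / 3 ->
    `|r - rn'| <= e / 3 -> `|A - U| <= K * s + (M + rn') ->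
    `|A - B| <= K * SS' + (M + r) + e.
  rewrite !ler_norml => /andP[? ?] H2 /andP[? ?] /andP[? ?].
  have : K * (s - SS') <= K * `|SS' - s|.
    by rewrite ler_wpM2l// distrC ler_norm.
  by move=> ?; apply/andP; split; lra.
exact: aux h1 h2' h3 (bound n).
Qed.

End test_function.
End malliavin_stein.

(** * The two bounds for a single test function *)

Section stein_malliavin_bounds.
Context d (T : measurableType d) (R : realType) (P : probability T R).
Context (dE : nat -> measure_display) (E : forall n, measurableType (dE n)).
Variable X : forall n, {RV P >-> E n}.
Hypothesis indepX : mutually_independent X.
Variable F : T -> R.
Hypothesis DF : D_dom X F.
Hypothesis EF0 : Ex P F = 0.
Notation a := (increment X F).
Notation b k := (Dk X k F).
Notation cond k := (cexp P (gen_except X k)).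
Notation stein_defect :=
  (Ex P (fun w => `|1 - limn (fun n => \sum_(0 <= k < n) a k w * b k w)|)).

Let sF : sq_integrable P F. Proof. exact: D_dom_sq_integrable DF. Qed.
Let sa k : sq_integrable P (a k). Proof. exact: sq_integrable_increment. Qed.
Let sb k : sq_integrable P (b k). Proof. exact: sq_integrable_Dk. Qed.

Lemma expectation_Ex (f : T -> R) : integrableR P f -> ('E_P[f] = (Ex P f)%:E)%E.
Proof. by move=> sf; rewrite unlock ExE. Qed.

Lemma expectation_series_norm (c : R) (g : nat -> T -> R) :
  (forall k, sq_integrable P (g k)) ->
  (forall k, Ex P (fun w => g k w ^+ 2) <= Ex P (fun w => a k w ^+ 2)) ->
  let S w : R := limn (fun n => \sum_(0 <= k < n) g k w * b k w) in
  integrableR P (fun w => `|c - S w|) /\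
  Ex P (fun w => `|c - \sum_(0 <= k < n) g k w * b k w|) @[n --> \oo] -->
    Ex P (fun w => `|c - S w|).
Proof.
move=> sg ga S.
have sgb k : integrableR P (fun w => g k w * b k w) by exact: sq_integrableM.
have [C HC] := sum_Ex_normM_le indepX DF sg ga.
exact: (@Ex_norm_series_cvg _ T R P (fun k w => g k w * b k w)
  (fun k => integrableR_measurable (sgb k)) C sgb HC c).
Qed.

Lemma expectation_stein_defect :
  ('E_P[(fun w => `|1 - limn (fun n => \sum_(0 <= k < n) a k w * b k w)|)%R] =
   stein_defect%:E)%E.
Proof.
by apply: expectation_Ex; have [] := expectation_series_norm 1 sa (fun k => lexx _).
Qed.

Lemma wasserstein_test (h : R -> R) : (forall x y, `|h x - h y| <= `|x - y|) ->
  (`|'E_P[h \o F] - (gauss_int h)%:E| <=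
   (Num.sqrt (2 / pi))%:E *
     'E_P[(fun w => `|1 - limn (fun n => \sum_(0 <= k < n) a k w * b k w)|)%R]
   + \sum_(0 <= k <oo) 'E_P[(fun w => `|a k w| * b k w ^+ 2)%R])%E.
Proof.
move=> h_lip; rewrite expectation_stein_defect -EFinM.
have f_lip x y : `|stein_lip h x - stein_lip h y| <= Num.sqrt (2 / pi) * `|x - y|.
  wlog xy : x y / y <= x => [wh|].
    by have [/wh//|/ltW/wh] := leP y x; rewrite distrC (distrC y).
  have [c _ ->] := is_derive_mean_value xy (fun t _ => is_derive_stein_lip h_lip t).
  by rewrite normrM ler_wpM2r ?stein_lip'_norm_le.
have mf1 : measurable_fun setT (stein_lip' h).
  exact: continuous_measurable_fun (continuous_stein_lip' h_lip).
have term_ge0 k : (0 <= 'E_P[(fun w => `|a k w| * b k w ^+ 2)%R])%E.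
  by apply: expectation_ge0 => w; rewrite mulr_ge0 ?sqr_ge0.
have rem_le n : (`|\sum_(k < n) Ex P (fun w =>
      a k w * taylor_rem (stein_lip h) (stein_lip' h) (F w) (F w - b k w))|%:E <=
    \sum_(0 <= k <oo) 'E_P[(fun w => `|a k w| * b k w ^+ 2)%R])%E.
  apply: le_trans (nneseries_lim_ge n (P := xpredT) _); last by move=> *; exact: term_ge0.
  apply: (@le_trans _ _ (\sum_(k < n) `|Ex P (fun w =>
      a k w * taylor_rem (stein_lip h) (stein_lip' h) (F w) (F w - b k w))|)%:E).
    by rewrite lee_fin ler_norm_sum.
  rewrite big_mkord -sumEFin; apply: lee_sum => k _.
  have ir := integrable_increment_rem DF mf1 f_lip (stein_lip'_norm_le h_lip) k.
  apply: le_trans (_ : _ <= (Ex P (fun w => `|a k w * taylor_rem (stein_lip h)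
    (stein_lip' h) (F w) (F w - b k w)|))%:E)%E _; first by rewrite lee_fin Ex_norm.
  rewrite -ExE ?integrableR_norm// unlock; apply: ge0_le_integral => //.
  - by apply: (measurable_int P); exact: integrableR_norm.
  - apply/measurable_EFinP; apply: measurable_funM.
      exact: measurableT_comp (sa k).1.
    exact: measurable_funX (sb k).1.
  - move=> w _; rewrite lee_fin normrM ler_wpM2l//.
    by have := stein_lip_remainder h_lip (F w) (F w - b k w); rewrite subKr.
(* The right-hand side may be infinite: the bound is then trivial, and only a finite sum [M] can be
   passed to [stein_bound]. *)
move: rem_le; case: (\sum_(0 <= k <oo) _)%E => [M| |] rem_le; last first.
- by have := rem_le 0%N; rewrite leeNy_eq.
- by rewrite addey// leey.
have := stein_bound indepX DF EF0 mf1 f_lip (stein_lip'_norm_le h_lip)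
  (M := M) (r := 0) (rn := fun=> 0) _ (cvg_cst _).
have ifF : integrableR P (fun w => F w * stein_lip h (F w)).
  by apply: sq_integrableM => //; exact: sq_integrable_lip_comp f_lip _ _.
have if1 : integrableR P (fun w => stein_lip' h (F w)).
  apply: le_integrableR (integrableR_cst P (Num.sqrt (2 / pi))).
    exact: measurableT_comp mf1 sF.1.
  by move=> w; rewrite (le_trans (stein_lip'_norm_le h_lip _))// ler_norm.
have shF : integrableR P (h \o F).
  apply: sq_integrableW; apply: (@sq_integrable_lip_comp _ _ _ _ h 1) => // x y.
  by rewrite mul1r.
rewrite -ExB// addr0 expectation_Ex// -EFinB abse_EFin -EFinD lee_fin.
have -> : (fun w => stein_lip' h (F w) - F w * stein_lip h (F w)) =
    (fun w => h (F w) - gauss_int h).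
  by apply/funext => w; rewrite /stein_lip'; ring.
rewrite ExB ?Ex_cst//; last exact: integrableR_cst.
by apply => n; rewrite -lee_fin.
Qed.

Section kolmogorov.
Variable z : R.
Notation f := (stein_ind z).
Notation f1 := (stein_ind' z).
Notation g := (stein_ind_mono z).
Let A k w : R := `|a k w|.
Let dA k := Dk X k (A k).
Let cA k := cond k (A k).

Let sA k : sq_integrable P (A k). Proof. exact: sq_integrable_norm. Qed.
Let sdA k : sq_integrable P (dA k). Proof. exact: sq_integrable_Dk. Qed.
Let scA k : sq_integrable P (cA k). Proof. exact: sq_integrable_cexp. Qed.

(** The constant is 1 for the linear part plus 2 for the remainder, as [g] varies by at most 2. It
    only serves the continuity and integrability of [f] along [F]. *)
Lemma stein_ind_lip x y : `|f x - f y| <= 3 * `|x - y|.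
Proof.
have rem_le := stein_ind_remainder z x y.
have -> : f x - f y = (f x - f y - f1 x * (x - y)) + f1 x * (x - y) by ring.
apply: le_trans (ler_normD _ _) _.
have : `|f1 x * (x - y)| <= 1 * `|x - y|.
  by rewrite normrM ler_wpM2r ?stein_ind'_norm_le1.
have : (x - y) * (g x - g y) <= 2 * `|x - y|.
  apply: le_trans (ler_norm _) _; rewrite normrM mulrC ler_wpM2r//.
  apply: le_trans (ler_normB _ _) _.
  by have := stein_ind_mono_norm_le1 z x; have := stein_ind_mono_norm_le1 z y; lra.
lra.
Qed.

Let mgF : measurable_fun [set: T] (g \o F).
Proof. exact: measurableT_comp (measurable_stein_ind_mono z) sF.1. Qed.

Let mgcF k : G_measurable (gen_except X k) (g \o cond k F).
Proof.
have [mY _ _] := is_cexp_cond X k sF.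
exact: measurableT_comp (measurable_stein_ind_mono z) mY.
Qed.

Let sbg k (Y : T -> R) : measurable_fun [set: T] (g \o Y) ->
  sq_integrable P (fun w => b k w * g (Y w)).
Proof.
move=> mY; apply: (@sq_integrable_bounded _ _ _ P 1 (b k) (g \o Y)) => // w.
exact: stein_ind_mono_norm_le1.
Qed.

(* [|rem| <= D_k F (g(F) - g(F - D_k F))] with [g] monotone and bounded by 1;
   the part of [|a_k|] in [G_k] contributes nothing against [g(F - D_k F)]. *)
Lemma Ex_increment_rem_le k :
  `|Ex P (fun w => a k w * taylor_rem f f1 (F w) (F w - b k w))| <=
  2 * Ex P (fun w => `|dA k w * b k w|) + Ex P (fun w => g (F w) * (cA k w * b k w)).
Proof.
have mcF := G_measurableW (@sub_gen _ _ _ _ _ _ X _) (@mgcF k).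
have sbF := sbg k mgF; have sbcF := sbg k mcF.
have ir := integrable_increment_rem DF (measurable_stein_ind' z)
  stein_ind_lip (stein_ind'_norm_le1 z) k.
have i1 := sq_integrableM (sdA k) sbF; have i2 := sq_integrableM (scA k) sbF.
have i3 := sq_integrableM (sdA k) sbcF.
have i4 := sq_integrableM (scA k) sbcF.
have o4 : Ex P (fun w => cA k w * (b k w * g (cond k F w))) = 0.
  have [mcA _ _] := is_cexp_cond X k (sA k).
  have mY : G_measurable (gen_except X k) (fun w => cA k w * g (cond k F w)).
    exact: measurable_funM mcA (@mgcF k).
  have sY : sq_integrable P (fun w => cA k w * g (cond k F w)).
    apply: (@sq_integrable_bounded _ _ _ P 1 (cA k) (g \o cond k F)) => // w.
    exact: stein_ind_mono_norm_le1.
  rewrite -[RHS](Dk_orthogonal sF mY sY).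
  by congr (Ex P); apply/funext => w; ring.
have dom w : `|a k w * taylor_rem f f1 (F w) (F w - b k w)| <=
    (dA k w * (b k w * g (F w)) + cA k w * (b k w * g (F w))) -
    (dA k w * (b k w * g (cond k F w)) + cA k w * (b k w * g (cond k F w))).
  have -> : (dA k w * (b k w * g (F w)) + cA k w * (b k w * g (F w))) -
      (dA k w * (b k w * g (cond k F w)) + cA k w * (b k w * g (cond k F w))) =
      A k w * (b k w * (g (F w) - g (cond k F w))).
    by rewrite /dA /Dk /= -/(cA k w); ring.
  rewrite normrM ler_wpM2l//.
  have := stein_ind_remainder z (F w) (F w - b k w).
  have bE : b k w = F w - cond k F w by [].
  by rewrite /taylor_rem bE !subKr.
apply: le_trans (Ex_norm ir) _.
apply: le_trans (Ex_le (integrableR_norm ir)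
  (integrableRB (integrableRD i1 i2) (integrableRD i3 i4)) dom) _.
rewrite (ExB (integrableRD i1 i2) (integrableRD i3 i4)) (ExD i1 i2) (ExD i3 i4) o4 addr0.
have sdAb := sq_integrableM (sdA k) (sb k).
(* Used with [Y = F] and with [Y = E[F | G_k]], which produces the factor 2. *)
have bound (Y : T -> R) : integrableR P (fun w => dA k w * (b k w * g (Y w))) ->
    `|Ex P (fun w => dA k w * (b k w * g (Y w)))| <= Ex P (fun w => `|dA k w * b k w|).
  move=> iY; apply: le_trans (Ex_norm iY) _.
  apply: Ex_le; [exact: integrableR_norm|exact: integrableR_norm|] => w.
  by rewrite mulrA normrM ler_piMr ?stein_ind_mono_norm_le1.
have := bound _ i1; have := bound _ i3; rewrite !ler_norml.
have -> : (fun w => g (F w) * (cA k w * b k w)) = (fun w => cA k w * (b k w * g (F w))).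
  by apply/funext => w; ring.
have aux (e1 e2 e3 m : R) : - m <= e3 <= m -> - m <= e1 <= m ->
    e1 + e2 - e3 <= 2 * m + e2.
  by move=> /andP[? ?] /andP[? ?]; lra.
exact: aux.
Qed.

Lemma kolmogorov_test :
  (`|(Ex P (fun w => (F w <= z)%R%:R))%:E - (Phi z)%:E| <=
   'E_P[(fun w => `|1 - limn (fun n => \sum_(0 <= k < n) a k w * b k w)|)%R]
     + 2%:E * \sum_(0 <= k <oo) 'E_P[(fun w => `|dA k w * b k w|)%R]
     + 2%:E * 'E_P[(fun w =>
         `|limn (fun n => \sum_(0 <= k < n) cA k w * b k w)|)%R])%E.
Proof.
rewrite expectation_stein_defect.
have cA_le k : Ex P (fun w => cA k w ^+ 2) <= Ex P (fun w => a k w ^+ 2).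
  have [_ le] := is_cexp_contraction (@sub_gen _ _ _ _ _ _ X _) (sA k) (is_cexp_cond X k (sA k)).
  apply: le_trans le _; rewrite le_eqVlt; apply/orP; left; apply/eqP.
  by congr (Ex P); apply/funext => w; rewrite /A real_normK ?num_real.
(* Conditioning does not increase the energy of [|a_k|], so this series converges like the one of
   the Stein defect. *)
have [iS cS] := expectation_series_norm 0 scA cA_le.
have sdAb k := sq_integrableM (sdA k) (sb k).
have scAb k := sq_integrableM (scA k) (sb k).
have -> : ('E_P[(fun w => `|limn (fun n => \sum_(0 <= k < n) cA k w * b k w)|)%R] =
    (Ex P (fun w => `|0 - limn (fun n => \sum_(0 <= k < n) cA k w * b k w)|))%:E)%E.
  rewrite -expectation_Ex//; congr expectation; apply/funext => w.
  by rewrite sub0r normrN.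
set SC := Ex P _ in cS *.
have SC0 : 0 <= SC by apply: Ex_ge0.
have rem_le n : (`|\sum_(k < n) Ex P (fun w =>
      a k w * taylor_rem f f1 (F w) (F w - b k w))|%:E <=
    2%:E * \sum_(0 <= k <oo) 'E_P[(fun w => `|dA k w * b k w|)%R] +
    (Ex P (fun w => `|0 - \sum_(0 <= k < n) cA k w * b k w|))%:E)%E.
  apply: (@le_trans _ _ (2%:E * \sum_(0 <= k < n) 'E_P[(fun w => `|dA k w * b k w|)%R] +
    (Ex P (fun w => `|0 - \sum_(0 <= k < n) cA k w * b k w|))%:E)%E); last first.
    apply: leeD2r; apply: lee_wpmul2l; first by rewrite lee_fin.
    by apply: nneseries_lim_ge => k _ _; apply: expectation_ge0.
  rewrite big_mkord; under [X in (_ <= 2%:E * X + _)%E]eq_bigr do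
    rewrite expectation_Ex ?integrableR_norm//.
  rewrite sumEFin -EFinM -EFinD lee_fin.
  apply: le_trans (ler_norm_sum _ _ _) _.
  apply: (@le_trans _ _ (\sum_(k < n) (2 * Ex P (fun w => `|dA k w * b k w|) +
      Ex P (fun w => g (F w) * (cA k w * b k w))))).
    by apply: ler_sum => k _; exact: Ex_increment_rem_le.
  rewrite big_split/= -mulr_sumr lerD2l.
  have igc k : integrableR P (fun w => g (F w) * (cA k w * b k w)).
    have := sq_integrableM (scA k) (sbg k mgF).
    by congr (integrableR P _); apply/funext => w; ring.
  (* The factor [g (F w)] does not depend on [k]: the sum is moved inside the expectation before
     [|g| <= 1] is used, which keeps the absolute value outside the series. *)
  rewrite -(big_mkord xpredT (fun k => Ex P (fun w => g (F w) * (cA k w * b k w)))).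
  rewrite -Ex_sum//; apply: Ex_le; first exact: integrableR_sum.
    apply: integrableR_norm; apply: integrableRB; first exact: integrableR_cst.
    exact: integrableR_sum.
  move=> w; rewrite sub0r normrN -mulr_sumr.
  apply: le_trans (ler_norm _) _; rewrite normrM ler_piMl//.
  exact: stein_ind_mono_norm_le1.
have sum0 : (0 <= \sum_(0 <= k <oo) 'E_P[(fun w => `|dA k w * b k w|)%R])%E.
  by apply: nneseries_ge0 => k _ _; apply: expectation_ge0.
move: sum0 rem_le; case: (\sum_(0 <= k <oo) _)%E => [M| |] // _ rem_le; last first.
  by rewrite mulry gtr0_sg// mul1e addey// addye// leey.
have := stein_bound indepX DF EF0 (measurable_stein_ind' z) stein_ind_lip
  (stein_ind'_norm_le1 z) (M := 2 * M) _ cS.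
have sfF := sq_integrable_lip_comp stein_ind_lip sF.
have ifF : integrableR P (fun w => F w * f (F w)) by exact: sq_integrableM sF sfF.
have if1 : integrableR P (fun w => f1 (F w)).
  apply: le_integrableR (integrableR_cst P 1).
    exact: measurableT_comp (measurable_stein_ind' z) sF.1.
  by move=> w; rewrite normr1 stein_ind'_norm_le1.
have sind : integrableR P (fun w => (F w <= z)%R%:R).
  apply: le_integrableR (integrableR_cst P 1).
    exact: measurableT_comp (measurable_le_indicator z) sF.1.
  by move=> w; rewrite normr1; case: (F w <= z); rewrite ?normr1 ?normr0.
rewrite -ExB// mul1r -!EFinM -EFinB abse_EFin -!EFinD lee_fin.
have -> : (fun w => f1 (F w) - F w * f (F w)) = (fun w => (F w <= z)%R%:R - Phi z).
  by apply/funext => w; rewrite /stein_ind'; ring.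
rewrite ExB ?Ex_cst//; last exact: integrableR_cst.
rewrite -/SC => H; apply: le_trans (H _) _.
  by move=> n; rewrite -lee_fin EFinD EFinM.
(* The argument yields [SC] once; [SC0] weakens it to the factor 2 of the statement. *)
by rewrite -addrA lerD2l lerD2l; lra.
Qed.

End kolmogorov.
End stein_malliavin_bounds.

Theorem theorem3p7 (R : realType)
    (d : measure_display) (T : measurableType d) (P : probability T R)
    (dE : nat -> measure_display) (E : forall n, measurableType (dE n))
    (X : forall n, {RV P >-> E n})
    (d' : measure_display) (T' : measurableType d') (P' : probability T' R)
    (F : {RV P >-> R}) (Z : {RV P' >-> R}) :
  mutually_independent X ->
  D_dom X F ->
  ('E_P[F] = 0)%E ->
  standard_normal Z ->
  let D := Dk X in
  let a := fun k => D k (cexp P (gen_upto X k.+1) F) in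
  (dW F Z <=
     (Num.sqrt (2 / pi))%:E *
       'E_P[(fun w => `|1 - limn (fun n => \sum_(0 <= k < n) a k w * D k F w)|)%R]
     + \sum_(0 <= k <oo) 'E_P[(fun w => `|a k w| * D k F w ^+ 2)%R])%E
  /\
  (dK F Z <=
     'E_P[(fun w => `|1 - limn (fun n => \sum_(0 <= k < n) a k w * D k F w)|)%R]
     + 2%:E * \sum_(0 <= k <oo)
         'E_P[(fun w => `|D k (fun w' => `|a k w'|) w * D k F w|)%R]
     + 2%:E *
         'E_P[(fun w => `|limn (fun n => \sum_(0 <= k < n)
                 cexp P (gen_except X k) (fun w' => `|a k w'|) w * D k F w)|)%R])%E.
Proof.
move=> indepX DF EF stdZ D a.
have sF := D_dom_sq_integrable DF.
have EF0 : Ex P F = 0 by move: EF; rewrite unlock /Ex /Rintegral => ->.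
split.
  apply: ge_ereal_sup => _ [h h_lip <-].
  have {}h_lip x y : `|h x - h y| <= `|x - y|.
    by rewrite -(mul1r `|x - y|); exact: (h_lip (x, y)).
  rewrite (expectation_standard_normal stdZ); last 2 first.
  - exact: continuous_measurable_fun (lip_continuous h_lip).
  - exact: lip_phi_integrable h_lip.
  exact: (wasserstein_test indepX DF EF0 h_lip).
apply: ge_ereal_sup => _ [z _ <-]; rewrite (cdf_standard_normal stdZ).
(* The distribution function is written as an expectation, the form in which the Stein equation is
   applied. *)
suff -> : cdf F z = (Ex P (fun w => (F w <= z)%R%:R))%:E.
  exact: (kolmogorov_test indepX DF EF0 z).
have FzE : F @^-1` `]-oo, z] = [set w | F w <= z].
  by apply/seteqP; split=> w /=; rewrite in_itv.
have mFz : measurable [set w | F w <= z].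
  by rewrite -FzE; exact: measurable_funPTI.
rewrite -expectation_Ex; last first.
  apply: le_integrableR (integrableR_cst P 1).
    exact: measurableT_comp (measurable_le_indicator z) sF.1.
  by move=> w; rewrite normr1; case: (F w <= z); rewrite ?normr1 ?normr0.
rewrite /cdf /distribution /pushforward FzE -expectation_indic//.
congr expectation; apply/funext => w.
by rewrite indicE; congr (nat_of_bool _)%:R; apply/idP/idP; rewrite inE.
Qed.
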